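(* Let $n\geq 7$ be an integer such that the congruence $x^2+x+1\equiv 0 \pmod n$ has a solution $r\in\mathbb{Z}_n$, and let $\mathcal{NCG}_{18n^3}$ be the graph defined in the context below. Then $\mathcal{NCG}_{18n^3}$ is a connected cubic symmetric (i.e. arc-transitive) graph which is not a Cayley graph. Moreover, its full automorphism group $\mathrm{Aut}(\mathcal{NCG}_{18n^3})$ is solvable and of type $2^2$.
   Context: Fix $n\ge 7$ and $r\in\mathbb{Z}_n$ with $r^2+r+1\equiv 0\pmod n$. Let $K=\langle a,b,c,h \mid a^n=b^n=c^n=h^3=[a,b]=[a,c]=[b,c]=1,\ a^h=a^r,\ b^h=b^r,\ c^h=c^r\rangle\cong \mathbb{Z}_n^3\rtimes\mathbb{Z}_3$ (here $x^h=h^{-1}xh$), a group of order $3n^3$. Let $\{\mathbf{u},\mathbf{v},\mathbf{w},\mathbf{x},\mathbf{y},\mathbf{z}\}$ be six symbols. The graph $\mathcal{NCG}_{18n^3}$ has vertex set $\{\mathbf{u},\mathbf{v},\mathbf{w},\mathbf{x},\mathbf{y},\mathbf{z}\}\times K$ and edge set consisting, for every $g\in K$, of the edges $\{(\mathbf u,g),(\mathbf x,g)\}$, $\{(\mathbf u,g),(\mathbf y,g)\}$, $\{(\mathbf u,g),(\mathbf z,g)\}$, $\{(\mathbf v,g),(\mathbf x,gh^{-1}b)\}$, $\{(\mathbf v,g),(\mathbf y,g)\}$, $\{(\mathbf v,g),(\mathbf z,gh)\}$, $\{(\mathbf w,g),(\mathbf x,gh^{-1}a)\}$, $\{(\mathbf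 w,g),(\mathbf y,ghc)\}$, $\{(\mathbf w,g),(\mathbf z,g)\}$. An $s$-arc in a graph is a sequence $(v_0,\dots,v_s)$ of vertices with $v_{i-1}$ adjacent to $v_i$ for $1\le i\le s$ and $v_{i-1}\ne v_{i+1}$ for $1\le i<s$. For a connected cubic graph $\Gamma$ and $G\le\mathrm{Aut}(\Gamma)$, $\Gamma$ is $(G,2)$-regular if $G$ acts regularly (transitively with trivial stabilizers) on the set of $2$-arcs. A group $G\le \mathrm{Aut}(\Gamma)$ acting $2$-regularly on a connected cubic graph $\Gamma$ is said to be of type $2^1$ if $G$ contains an involution interchanging the two ends of some edge, and of type $2^2$ otherwise; the automorphism group of $\Gamma$ being ''of type $2^2$'' means $\Gamma$ is $(\mathrm{Aut}(\Gamma),2)$-regular and $\mathrm{Aut}(\Gamma)$ contains no involution swapping two adjacent vertices. A graph is a Cayley graph iff its automorphism group contains a subgroup acting regularly on the vertex set. *)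

(* Defs.v *)
From HB Require Import structures.
From mathcomp Require Import all_boot all_order all_algebra all_fingroup all_solvable.
Set Implicit Arguments. Unset Strict Implicit. Unset Printing Implicit Defensive.
Import GRing.Theory.

Definition GAut (T : finType) (e : rel T) : {set {perm T}} :=
  [set p : {perm T} | [forall x, forall y, e (p x) (p y) == e x y]].

Definition connected_graph (T : finType) (e : rel T) : Prop :=
  forall x y : T, connect e x y.

Definition cubic (T : finType) (e : rel T) : Prop :=
  forall x : T, #|[set y | e x y]| = 3.

Definition arc_transitive (T : finType) (e : rel T) : Prop :=
  forall x y x' y' : T, e x y -> e x' y' ->
    exists2 g, g \in GAut e & g x = x' /\ g y = y'.

Definition two_arc (T : finType) (e : rel T) (a b c : T) : bool :=
  [&& e a b, e b c & a != c].

Definition two_regular (T : finType) (e : rel T) (G : {set {perm T}}) : Prop :=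
  (forall a b c a' b' c', two_arc e a b c -> two_arc e a' b' c' ->
     exists2 g, g \in G & [/\ g a = a', g b = b' & g c = c'])
  /\ (forall g a b c, g \in G -> two_arc e a b c ->
        g a = a -> g b = b -> g c = c -> g = 1%g).

Definition type22 (T : finType) (e : rel T) (G : {set {perm T}}) : Prop :=
  two_regular e G /\
  ~ (exists g x y, [/\ g \in G, #[g]%g = 2, e x y, g x = y & g y = x]).

Definition regular_on_vertices (T : finType) (R : {set {perm T}}) : Prop :=
  (forall x y : T, exists2 p, p \in R & p x = y) /\
  (forall p x, p \in R -> p x = x -> p = 1%g).

Definition is_cayley (T : finType) (e : rel T) : Prop :=
  exists R : {group {perm T}}, R \subset GAut e /\ regular_on_vertices R.

(* An element (f, (v1,v2,v3)) stands for h^f a^v1 b^v2 c^v3.  Since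
   h^-1 x h = x^r for x in <a,b,c>, the product is
   (h^e v)(h^f w) = h^(e+f) (r^f v + w). *)
Definition Kt (n : nat) := ('Z_3 * ('Z_n * 'Z_n * 'Z_n))%type.

Definition kmul (n : nat) (r : 'Z_n) (g k : Kt n) : Kt n :=
  let: (e, (x1, x2, x3)) := g in
  let: (f, (y1, y2, y3)) := k in
  (e + f, (r ^+ f * x1 + y1, r ^+ f * x2 + y2, r ^+ f * x3 + y3))%R.

Definition kh (n : nat) : Kt n := (1%R, (0%R, 0%R, 0%R)).
Definition khinv (n : nat) : Kt n := ((-1)%R, (0%R, 0%R, 0%R)).
Definition ka (n : nat) : Kt n := (0%R, (1%R, 0%R, 0%R)).
Definition kb (n : nat) : Kt n := (0%R, (0%R, 1%R, 0%R)).
Definition kc (n : nat) : Kt n := (0%R, (0%R, 0%R, 1%R)).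

(* labels: u = 0, v = 1, w = 2, x = 3, y = 4, z = 5 *)
Definition NV (n : nat) := ('I_6 * Kt n)%type.

Definition ncg_edge0 (n : nat) (r : 'Z_n) (p q : NV n) : bool :=
  let: (i, g) := p in
  let: (j, k) := q in
  let m := kmul r in
  match nat_of_ord i, nat_of_ord j with
  | 0, 3 => k == g
  | 0, 4 => k == g
  | 0, 5 => k == g
  | 1, 3 => k == m (m g (khinv n)) (kb n)
  | 1, 4 => k == g
  | 1, 5 => k == m g (kh n)
  | 2, 3 => k == m (m g (khinv n)) (ka n)
  | 2, 4 => k == m (m g (kh n)) (kc n)
  | 2, 5 => k == g
  | _, _ => false
  end.

Definition ncg (n : nat) (r : 'Z_n) : rel (NV n) :=
  fun p q => ncg_edge0 r p q || ncg_edge0 r q p.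

(* Main.v *)
Require Import Defs.
From HB Require Import structures.
From mathcomp Require Import all_boot all_order all_algebra all_fingroup all_solvable.
From mathcomp Require Import integral_char.
From mathcomp Require Import ring zify.

(** The graph is the cover of K_{3,3} with voltages in K. Thirty-six automorphisms
    of K_{3,3} lift, and together with the left translations by K the lifts are
    transitive on 2-arcs and have two orbits on 3-arcs; the orbit ("turn") of a
    3-arc depends only on its labels and is switched by reversal. A 4-arc lies on a
    12-cycle exactly when its two 3-arcs have the same turn, so an arbitrary
    automorphism either preserves all turns or reverses all of them. One that
    preserves turns and fixes a 2-arc is trivial, so it remains to exclude a
    turn-reversing p, which may be taken to fix a 2-arc. Counting cycles of bounded
    length cannot do this, since complex conjugation reverses turns in the analogous
    cover over the Eisenstein integers. Instead, p is followed along two walks: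
    conjugation by p sends the translations by x = a and by a certain y in h Z_n^3
    to those by x' = b c^-1 and by some y' in h^-1 Z_n^3. Then x^y = x^r forces
    x'^(r^2) = x'^r, which contradicts n >= 7.

    An involution flipping an edge would map a 3-arc to its reverse, so there is
    none; a regular subgroup would contain one by parity. Finally the automorphisms
    that fix all vertices modulo Z_n^3 form an abelian normal subgroup of index
    108 = 2^2 3^3, and Burnside's theorem applies to the quotient. *)

Set Implicit Arguments. Unset Strict Implicit. Unset Printing Implicit Defensive.
Import GRing.Theory.
Local Open Scope ring_scope.

(** * Integer models of ['Z_n] and of K, for computation *)

(* Eisenstein integers x + y w with w^2 + w + 1 = 0, as pairs (x, y). *)
Definition eis := (int * int)%type.
Definition eis_add (x y : eis) : eis := (x.1 + y.1, x.2 + y.2).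
Definition eis_opp (x : eis) : eis := (- x.1, - x.2).
Definition eis_mul (x y : eis) : eis :=
  (x.1 * y.1 - x.2 * y.2, x.1 * y.2 + x.2 * y.1 - x.2 * y.2).
Definition eis_norm (x : eis) : int := x.1 ^+ 2 - x.1 * x.2 + x.2 ^+ 2.
Definition eis_wpow (f : nat) : eis :=
  match f with 0%N => (1, 0) | 1%N => (0, 1) | _ => (-1, -1) end.

(** Z[w]^3 extended by Z_3, the exponent of h being a residue below 3. It serves all n at once:
    equations computed here are carried to every [Kt n] by [ev]. *)
Definition eisK := (nat * (eis * eis * eis))%type.
Definition eisK_mul (g k : eisK) : eisK :=
  let: (e, (x1, x2, x3)) := g in
  let: (f, (y1, y2, y3)) := k in
  ((e + f) %% 3, (eis_add (eis_mul (eis_wpow f) x1) y1,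
                  eis_add (eis_mul (eis_wpow f) x2) y2,
                  eis_add (eis_mul (eis_wpow f) x3) y3))%N.
Definition eisK_inv (g : eisK) : eisK :=
  let: (e, (x1, x2, x3)) := g in
  let f := ((3 - e) %% 3)%N in
  (f, (eis_opp (eis_mul (eis_wpow f) x1), eis_opp (eis_mul (eis_wpow f) x2),
       eis_opp (eis_mul (eis_wpow f) x3))).
Definition eis0 : eis := (0, 0).
Definition eis1 : eis := (1, 0).
Definition eisK1 : eisK := (0%N, (eis0, eis0, eis0)).

Definition side (i : nat) := (i < 3)%N.

(* [volt i j] is the voltage of the dart from label [i] to label [j]: the
   neighbours of (i, g) are the (j, g (volt i j)). *)
Definition volt0 (i j : nat) : eisK :=
  match i, j with
  | 1, 3 => (2, (eis0, eis1, eis0))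
  | 1, 5 => (1, (eis0, eis0, eis0))
  | 2, 3 => (2, (eis1, eis0, eis0))
  | 2, 4 => (1, (eis0, eis0, eis1))
  | _, _ => eisK1
  end%N.
Definition volt (i j : nat) : eisK :=
  if side i then volt0 i j else eisK_inv (volt0 j i).

Definition kone (n : nat) : Kt n := (0, (0, 0, 0)).
Definition kinv n (r : 'Z_n) (g : Kt n) : Kt n :=
  let: (e, (x1, x2, x3)) := g in
  let q := r ^+ nat_of_ord (- e) in (- e, (- (q * x1), - (q * x2), - (q * x3))).

Lemma all_label (P : pred nat) : all P (iota 0 6) -> forall i : 'I_6, P i.
Proof. by move/allP=> h i; apply: h; rewrite mem_iota ltn_ord. Qed.

(** * The group K and the evaluation at w = r *)

Section Voltage.
Variables (n : nat) (r : 'Z_n).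
Hypothesis r_root : r ^+ 2 + r + 1 = 0.

Lemma r_sqr : r ^+ 2 = - r - 1.
Proof. by apply/eqP; rewrite -subr_eq0 -r_root; apply/eqP; ring. Qed.

Lemma r_cube : r ^+ 3 = 1.
Proof. by rewrite exprS r_sqr mulrBr mulrN -expr2 r_sqr; ring. Qed.

Lemma expZ3D (e f : 'Z_3) : r ^+ nat_of_ord (e + f)%R = r ^+ e * r ^+ f.
Proof. by rewrite -exprD -(expr_mod (e + f)%N r_cube). Qed.

Local Notation "g ** k" := (kmul r g k) (at level 40, left associativity).

Lemma kmulA g h k : g ** (h ** k) = g ** h ** k.
Proof.
case: g h k => [e [[x1 x2] x3]] [f [[y1 y2] y3]] [d [[z1 z2] z3]] /=.
by rewrite addrA !expZ3D; congr (_, (_, _, _)); ring.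
Qed.

Lemma kmul1 g : g ** kone n = g.
Proof. by case: g => [e [[x1 x2] x3]] /=; rewrite !addr0 !mul1r. Qed.

Lemma k1mul g : kone n ** g = g.
Proof. by case: g => [e [[x1 x2] x3]] /=; rewrite !mulr0 !add0r. Qed.

Lemma kmulV g : g ** kinv r g = kone n.
Proof. by case: g => [e [[x1 x2] x3]] /=; rewrite !subrr. Qed.

Lemma kVmul g : kinv r g ** g = kone n.
Proof.
case: g => [e [[x1 x2] x3]] /=.
have q : r ^+ e * r ^+ nat_of_ord (- e) = 1 by rewrite -expZ3D subrr.
by rewrite addNr !mulrN !mulrA q !mul1r !addNr.
Qed.

Lemma kmul_injr g h k : g ** h = g ** k -> h = k.
Proof.
by move=> /(congr1 (kmul r (kinv r g))); rewrite !kmulA kVmul !k1mul.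
Qed.

Lemma kinv_unique g h : g ** h = kone n -> h = kinv r g.
Proof. by move=> gh; apply: (@kmul_injr g); rewrite gh kmulV. Qed.

(** The ring homomorphism from Z[w] to ['Z_n] sending w to [r], a root of the same polynomial. *)
Definition eis_ev (x : eis) : 'Z_n := x.1%:~R + x.2%:~R * r.
Definition ev (g : eisK) : Kt n :=
  let: (e, (x1, x2, x3)) := g in (inZp e, (eis_ev x1, eis_ev x2, eis_ev x3)).

Lemma eis_evD x y : eis_ev (eis_add x y) = eis_ev x + eis_ev y.
Proof. by rewrite /eis_ev /= !rmorphD /=; ring. Qed.

Lemma eis_evN x : eis_ev (eis_opp x) = - eis_ev x.
Proof. by rewrite /eis_ev /= !rmorphN /=; ring. Qed.

Lemma eis_evM x y : eis_ev (eis_mul x y) = eis_ev x * eis_ev y.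
Proof.
rewrite /eis_ev /= !(rmorphB, rmorphD, rmorphM) /=.
set a := x.1%:~R; set b := x.2%:~R; set c := y.1%:~R; set d := y.2%:~R.
have -> : (a + b * r) * (c + d * r) = a * c + (a * d + b * c) * r + b * d * r ^+ 2
  by ring.
by rewrite r_sqr; ring.
Qed.

Lemma eis_ev_wpow f : (f < 3)%N -> eis_ev (eis_wpow f) = r ^+ f.
Proof.
case: f => [|[|[|//]]] _; rewrite /eis_ev /=; try by rewrite ?expr0 ?expr1; ring.
by rewrite r_sqr; ring.
Qed.

Lemma ev1 : ev eisK1 = kone n.
Proof. by rewrite /ev /eis_ev /= mul0r addr0; congr (_, _); apply/val_inj. Qed.

(** Only the exponent of the right factor acts on coordinates, through [eis_wpow], which is correct
    below 3; hence the bound on [h]. *)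
Lemma evM g h : (h.1 < 3)%N -> ev (eisK_mul g h) = ev g ** ev h.
Proof.
case: g h => [e [[x1 x2] x3]] [f [[y1 y2] y3]] /= f3.
rewrite !eis_evD !eis_evM !eis_ev_wpow // /= (modn_small f3).
by congr (_, _); apply/val_inj; rewrite /= modn_mod (modn_small f3) modnDml.
Qed.
End Voltage.

(* Multiplying by the conjugate, eis_ev x = 0 forces n to divide the norm of x. *)
Lemma eis_ev_neq0 n (r : 'Z_n) x : r ^+ 2 + r + 1 = 0 -> (7 <= n)%N ->
  eis_norm x \in [:: 1; 3; 4] -> eis_ev r x != 0.
Proof.
move=> r_root n7 nx; apply/eqP=> x0.
have : eis_ev r x * eis_ev r (x.1 - x.2, - x.2) = (eis_norm x)%:~R.
  rewrite -(eis_evM r_root) /eis_mul /eis_ev /= /eis_norm.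
  have -> : x.1 * - x.2 + x.2 * (x.1 - x.2) - x.2 * - x.2 = 0 by ring.
  by rewrite mul0r addr0; congr _%:~R; ring.
rewrite x0 mul0r => /esym N0.
suff [m m4 m0] : exists2 m : nat, (0 < m <= 4)%N & m%:R = 0 :> 'Z_n.
  move/(congr1 (@nat_of_ord _)): m0; rewrite val_Zp_nat ?(leq_trans _ n7) //=.
  by rewrite modn_small; lia.
by move: nx N0; rewrite !inE => /or3P[] /eqP->; [exists 1%N|exists 3%N|exists 4%N].
Qed.

Lemma volt_lt3 i j : ((volt i j).1 < 3)%N.
Proof.
rewrite /volt /eisK_inv; case: ifP => _; last first.
  by case: (volt0 j i) => e [[? ?] ?] /=; rewrite ltn_mod.
by move: i j => [|[|[|i]]] [|[|[|[|[|[|j]]]]]].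
Qed.

(** * The graph as a cover of K_{3,3} *)

Section Graph.
Variables (n : nat) (r : 'Z_n).
Hypothesis r_root : r ^+ 2 + r + 1 = 0.
Local Notation "g ** k" := (kmul r g k) (at level 40, left associativity).
Local Notation V i j := (ev r (volt i j)).
Local Notation e := (ncg r).

Lemma ev_inv g : (g.1 < 3)%N -> ev r (eisK_inv g) = kinv r (ev r g).
Proof.
move=> g3; apply: (kinv_unique r_root); rewrite -(evM r_root); last first.
  by case: g g3 => f [[? ?] ?] _ /=; rewrite ltn_mod.
rewrite -(ev1 r); case: g g3 => f [[[a b] [c d]] [p q]] /= f3.
rewrite !eis_evD !eis_evN ?subrr ?addNr.
rewrite /eis_ev /= mul0r addr0; congr (_, _); apply/val_inj => /=.
by move: f f3 => [|[|[|]]].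
Qed.

Lemma voltV i j : side i (+) side j -> V j i = kinv r (V i j).
Proof.
have volt0_lt3 k l : side k -> ((volt0 k l).1 < 3)%N.
  by move=> sk; have := volt_lt3 k l; rewrite /volt sk.
rewrite /volt; case si: (side i); case sj: (side j) => //= _.
  by rewrite ev_inv ?volt0_lt3.
by rewrite ev_inv ?volt0_lt3 //; apply: (kinv_unique r_root); apply: kVmul.
Qed.

Lemma volt_mulV i j : side i (+) side j -> V i j ** V j i = kone n.
Proof. by move=> ij; rewrite (voltV ij) kmulV. Qed.

Lemma ncg_edge0E (i j : 'I_6) g k :
  ncg_edge0 r (i, g) (j, k) = [&& side i, ~~ side j & k == g ** V i j].
Proof.
have two : (-1 : 'Z_3) = inZp 2 by apply/val_inj.
have one : (1 : 'Z_3) = inZp 1 by apply/val_inj.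
have e0 : eis_ev r (0, 0) = 0 by rewrite /eis_ev mul0r addr0.
have e1 : eis_ev r (1, 0) = 1 by rewrite /eis_ev mul0r addr0.
have z0 : inZp 0 = 0 :> 'Z_3 by apply/val_inj.
case: i => [[|[|[|[|[|[|//]]]]]] ?]; case: j => [[|[|[|[|[|[|//]]]]]] ?] //;
  case: g => [f [[x y] z]]; rewrite /ev /volt /= ?e0 ?e1 ?two ?z0 //.
all: by rewrite -?one ?expr0 ?mul1r ?addr0.
Qed.

(** One rule in place of the nine edge families and their reverses: a reversed dart carries the
    inverse voltage. *)
Lemma ncgE (i j : 'I_6) g k :
  e (i, g) (j, k) = (side i (+) side j) && (k == g ** V i j).
Proof.
rewrite /ncg !ncg_edge0E.
case si: (side i); case sj: (side j); rewrite //= ?andbF ?orbF //.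
apply/eqP/eqP => ->; rewrite -(kmulA r_root) volt_mulV ?si ?sj ?kmul1 //.
Qed.

Lemma ncg_sym : symmetric e.
Proof. by move=> p q; rewrite /ncg orbC. Qed.

Definition nbr (v : NV n) (j : 'I_6) : NV n := (j, v.2 ** V v.1 j).

Lemma ncg_nbr v j : e v (nbr v j) = side v.1 (+) side j.
Proof. by case: v => i g; rewrite ncgE eqxx andbT. Qed.

Lemma ncgP v w : e v w = (side v.1 (+) side w.1) && (w == nbr v w.1).
Proof.
by case: v w => i g [j k]; rewrite ncgE /nbr /= xpair_eqE eqxx.
Qed.

Lemma nbr_lab v w : e v w -> nbr v w.1 = w.
Proof. by rewrite ncgP => /andP[_ /eqP]. Qed.

(** Unique lifting: a vertex has at most one neighbour over each label. *)
Lemma ncg_inj v w w' : e v w -> e v w' -> w.1 = w'.1 -> w = w'.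
Proof. by move=> /nbr_lab vw /nbr_lab vw' ww'; rewrite -vw ww'. Qed.

Lemma ncg_side v w : e v w -> side w.1 = ~~ side v.1.
Proof. by rewrite ncgP => /andP[]; case: side; case: side. Qed.

Lemma card_side (b : bool) : #|[set j : 'I_6 | b (+) side j]| = 3%N.
Proof.
rewrite -sum1_card big_mkcond /= !big_ord_recl big_ord0 !inE /side /=.
by case: b.
Qed.

Lemma ncg_cubic : cubic e.
Proof.
move=> v; apply: etrans (card_side (side v.1)).
have <- : [set nbr v j | j in [set j : 'I_6 | side v.1 (+) side j]]
          = [set w | e v w].
  apply/setP=> w; rewrite inE; apply/imsetP/idP => [[j jv ->]|vw].
    by rewrite ncg_nbr; rewrite inE in jv.
  exists w.1; last by rewrite nbr_lab.
  by rewrite inE (ncg_side vw); case: side.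
by rewrite card_imset // => j k [].
Qed.

Definition ltr (k : Kt n) (v : NV n) : NV n := (v.1, k ** v.2).

(** Voltages multiply on the right, so left translations commute with them. *)
Lemma ltr_nbr k v j : ltr k (nbr v j) = nbr (ltr k v) j.
Proof. by rewrite /ltr /nbr /= (kmulA r_root). Qed.

Lemma ltrM k l v : ltr (k ** l) v = ltr k (ltr l v).
Proof. by rewrite /ltr (kmulA r_root). Qed.

Lemma ltr_injl k l v : ltr k v = ltr l v -> k = l.
Proof.
move/(congr1 snd) => kl; have {kl} : k ** v.2 = l ** v.2 by [].
move/(congr1 (fun g => g ** kinv r v.2)).
by rewrite -!(kmulA r_root) kmulV !kmul1.
Qed.

Lemma ltr1 v : ltr (kone n) v = v.
Proof. by case: v => i g; rewrite /ltr k1mul. Qed.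

End Graph.

(** * Connectedness: voltages of closed walks generate K *)

Section Connected.
Variables (n : nat) (r : 'Z_n).
Hypothesis r_root : r ^+ 2 + r + 1 = 0.
Local Notation "g ** k" := (kmul r g k) (at level 40, left associativity).
Local Notation V i j := (ev r (volt i j)).
Local Notation e := (ncg r).

Fixpoint walk_volt (i : nat) (s : seq nat) : eisK :=
  if s is j :: s' then eisK_mul (volt i j) (walk_volt j s') else eisK1.

Lemma walk_volt_lt3 i s : ((walk_volt i s).1 < 3)%N.
Proof.
case: s => [|j s] //=; case: (volt i j) => f [[? ?] ?].
by case: (walk_volt j s) => f' [[? ?] ?] /=; rewrite ltn_mod.
Qed.

Lemma connect_sym_ncg : connect_sym e.
Proof. exact/sym_connect_sym/ncg_sym. Qed.

Lemma connect_walk i s g : path (fun j k => side j (+) side k) i s ->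
  all (fun j => j < 6)%N (i :: s) ->
  connect e (inord i, g) (inord (last i s), g ** ev r (walk_volt i s)).
Proof.
elim: s i g => [|j s IH] i g; first by rewrite [walk_volt _ _]/= ev1 kmul1 connect0.
move=> /andP[ij js] /and3P[i6 j6 s6]; rewrite [walk_volt _ _]/= [last _ _]/=.
rewrite (evM r_root) ?walk_volt_lt3 // (kmulA r_root).
apply: connect_trans (IH _ _ js _); last by rewrite /= j6.
by apply: connect1; rewrite (ncgE r_root) !inordK // ij eqxx.
Qed.

Definition loopable k := forall g, connect e (inord 0, g) (inord 0, g ** k).

Lemma loopableM k l : loopable k -> loopable l -> loopable (k ** l).
Proof.
by move=> hk hl g; rewrite (kmulA r_root); apply: connect_trans (hk g) (hl _).
Qed.

Lemma loopable_all k : loopable k.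
Proof.
have walk s : path (fun j k => side j (+) side k) 0%N s ->
    all (fun j => j < 6)%N s -> last 0%N s = 0%N -> loopable (ev r (walk_volt 0 s)).
  by move=> ps s6 ls g; have := @connect_walk 0 s g ps s6; rewrite ls.
have e0 : eis_ev r eis0 = 0 by rewrite /eis_ev mul0r addr0.
have e1 : eis_ev r eis1 = 1 by rewrite /eis_ev mul0r addr0.
have z0 : inZp 0 = 0 :> 'Z_3 by apply/val_inj.
have z1 : inZp 1 = 1 :> 'Z_3 by apply/val_inj.
(* The circuit u, y, v, z, u has voltage h, which offsets the h^-1 in the voltage h^-1 a of the dart
   from w to x. The next two walks isolate b and c likewise. *)
have La : loopable (ka n).
  have := walk [:: 4; 1; 5; 0; 5; 2; 3; 0]%N isT isT (erefl _).
  by rewrite (_ : walk_volt _ _ = (0%N, (eis1, eis0, eis0))) // /ev e0 e1 z0.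
have Lb : loopable (kb n).
  have := walk [:: 4; 1; 5; 0; 4; 1; 3; 0]%N isT isT (erefl _).
  by rewrite (_ : walk_volt _ _ = (0%N, (eis0, eis1, eis0))) // /ev e0 e1 z0.
have Lc : loopable (kc n).
  have := walk [:: 5; 1; 4; 0; 5; 2; 4; 0]%N isT isT (erefl _).
  by rewrite (_ : walk_volt _ _ = (0%N, (eis0, eis0, eis1))) // /ev e0 e1 z0.
have Lh : loopable (kh n).
  have := walk [:: 4; 1; 5; 0]%N isT isT (erefl _).
  by rewrite (_ : walk_volt _ _ = (1%N, (eis0, eis0, eis0))) // /ev e0 z1.
have L1 : loopable (kone n) by move=> g; rewrite kmul1.
have LA m : loopable (0, (m%:R, 0, 0)).
  elim: m => [|m IH] //; have := loopableM IH La.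
  by rewrite /= expr0 !mul1r !addr0 natr1.
have LB m : loopable (0, (0, m%:R, 0)).
  elim: m => [|m IH] //; have := loopableM IH Lb.
  by rewrite /= expr0 !mul1r !addr0 natr1.
have LC m : loopable (0, (0, 0, m%:R)).
  elim: m => [|m IH] //; have := loopableM IH Lc.
  by rewrite /= expr0 !mul1r !addr0 natr1.
have LH m : loopable (m%:R, (0, 0, 0)).
  elim: m => [|m IH] //; have := loopableM IH Lh.
  by rewrite /= !mulr0 !addr0 natr1.
case: k => [f [[x y] z]].
have := loopableM (loopableM (loopableM (LH f) (LA x)) (LB y)) (LC z).
by rewrite !natr_Zp /= expr0 !mul1r !addr0 !add0r.
Qed.

Lemma ncg_connected : connected_graph e.
Proof.
have to0 v : exists g, connect e v (inord 0, g).
  case: v => i g; pose s := if side i then [:: 3; 0]%N else [:: 0]%N.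
  exists (g ** ev r (walk_volt i s)); rewrite -{1}(inord_val i).
  have := @connect_walk i s g; rewrite (_ : last _ s = 0%N) //; last by rewrite /s; case: ifP.
  by apply; rewrite /s; case: ifP => h /=; rewrite ?h ?ltn_ord.
move=> v w; have [g vg] := to0 v; have [k wk] := to0 w.
apply: connect_trans vg _; rewrite connect_sym_ncg; apply: connect_trans wk _.
by have := loopable_all (kinv r k ** g) k; rewrite (kmulA r_root) kmulV k1mul.
Qed.
End Connected.

(** * The automorphisms of a relation as a group *)

Section Automorphisms.
Variables (T : finType) (e : rel T).

Lemma GAutP (p : {perm T}) : reflect (forall x y, e (p x) (p y) = e x y) (p \in GAut e).
Proof.
rewrite inE; apply: (iffP forallP) => h x; last by apply/forallP=> y; rewrite h.
by move=> y; apply/eqP; move/forallP: (h x); apply.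
Qed.

Lemma GAut_group_set : group_set (GAut e).
Proof.
apply/group_setP; split=> [|p q /GAutP hp /GAutP hq].
  by apply/GAutP=> x y; rewrite !perm1.
by apply/GAutP=> x y; rewrite !permM hq hp.
Qed.
Canonical GAut_group := Group GAut_group_set.
End Automorphisms.

(** * Turns, and an exhaustive search for 12-cycles *)

(* With labels read modulo 3, this is (k - i)(l - j) = 1, negated when the 3-arc
   starts in {u, v, w}. *)
Definition turn (i j k l : nat) : bool :=
  ((k + 2 * i) %% 3 == (l + 2 * j) %% 3)%N (+) side i.

Definition label_step (i j l : nat) := (side j (+) side l) && (l != i).

(* The vm evaluates the arguments of [==>] and [&&] eagerly, hence the [if]s. *)
Fixpoint forall_walk k i j g (test : nat -> eisK -> bool) : bool :=
  if k is k'.+1 then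
    all (fun l => if label_step i j l then
           forall_walk k' j l (eisK_mul g (volt j l)) test else true) (iota 0 6)
  else test j g.

Fixpoint exists_walk k i j g (test : nat -> eisK -> bool) : bool :=
  if k is k'.+1 then
    has (fun l => if label_step i j l then
           exists_walk k' j l (eisK_mul g (volt j l)) test else false) (iota 0 6)
  else test j g.

(** Certifies nontriviality for all n >= 7 at once: by [eis_ev_neq0] a coordinate of norm 1, 3 or 4
    stays nonzero. *)
Definition visibly_nontrivial (g : eisK) : bool :=
  let: (e, (x1, x2, x3)) := g in
  (e != 0%N) || has (fun x => eis_norm x \in [:: 1; 3; 4]) [:: x1; x2; x3].

Definition volt4 i j k l m :=
  eisK_mul (eisK_mul (eisK_mul (volt i j) (volt j k)) (volt k l)) (volt l m).

(** Four steps and eight more make closed walks of length 12. For equal turns some continuation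
    closes up already over Z[w]; for unequal turns every continuation back to the label [i] has a
    voltage that is nontrivial for all n >= 7. *)
Definition turn_changes_open i j k l m : bool :=
  if ~~ [&& side i (+) side j, label_step i j k, label_step j k l
        & label_step k l m] then true
  else if turn i j k l == turn j k l m then
    exists_walk 8 l m (volt4 i j k l m) (fun i' g => (i' == i) && (g == eisK1))
  else forall_walk 8 l m (volt4 i j k l m)
         (fun i' g => if i' == i then visibly_nontrivial g else true).

Lemma turn_changes_openT (i j k l m : 'I_6) : turn_changes_open i j k l m.
Proof.
have : all (fun i => all (fun j => all (fun k => all (fun l => all (fun m =>
  turn_changes_open i j k l m) (iota 0 6)) (iota 0 6)) (iota 0 6)) (iota 0 6)) (iota 0 6).
  by vm_cast_no_check (erefl true).
move/all_label/(_ i)/all_label/(_ j)/all_label/(_ k)/all_label/(_ l)/all_label.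
exact.
Qed.

Lemma eisK_mul_lt3 g h : ((eisK_mul g h).1 < 3)%N.
Proof. by case: g h => [? [[? ?] ?]] [? [[? ?] ?]]; rewrite ltn_mod. Qed.

(** * 12-cycles detect whether consecutive turns agree *)

Section TwelveCycles.
Variables (n : nat) (r : 'Z_n).
Hypotheses (n7 : (7 <= n)%N) (r_root : r ^+ 2 + r + 1 = 0).
Local Notation "g ** k" := (kmul r g k) (at level 40, left associativity).
Local Notation V i j := (ev r (volt i j)).
Local Notation e := (ncg r).

Lemma visibly_nontrivialP g :
  (g.1 < 3)%N -> visibly_nontrivial g -> ev r g != kone n.
Proof.
case: g => [f [[x y] z]] f3 h; apply: contraTN h.
rewrite /kone /ev !xpair_eqE => /and3P[/eqP f0 /andP[/eqP x0 /eqP y0] /eqP z0].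
have nz t : eis_ev r t = 0 -> (eis_norm t \in [:: 1; 3; 4]) = false.
  by move=> t0; apply/negP=> /(eis_ev_neq0 r_root n7); rewrite t0 eqxx.
rewrite /visibly_nontrivial [has _ _]/= !nz // !orbF negbK.
by move/(congr1 val): f0; rewrite /= modn_small // => ->.
Qed.

Fixpoint nbwalk (a b : NV n) (p : seq (NV n)) : bool :=
  if p is c :: p' then [&& e b c, a != c & nbwalk b c p'] else true.

(** Eight edges lead back to [a] after the four of the 4-arc. Vertices may repeat; only immediate
    backtracking before the return to [a] is barred. *)
Definition on_12cycle (a b c d f : NV n) : Prop :=
  exists p, [/\ size p = 8, nbwalk d f p & last f p = a].

Lemma label_stepP (a b c : NV n) : e a b -> e b c ->
  label_step a.1 b.1 c.1 = (a != c).
Proof.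
move=> ab bc; rewrite /label_step (ncg_side r_root bc) addbN addbb /=.
congr (~~ _); apply/eqP/eqP => [ca|-> //].
by apply: (ncg_inj r_root _ bc (esym _)); [rewrite ncg_sym|apply/val_inj].
Qed.

(** A nonbacktracking walk is the lift of its label walk, and the accumulated voltage gives its
    endpoint relative to the fixed left factor [x]. *)
Lemma forall_walkP k (a b : NV n) x g test : forall_walk k a.1 b.1 g test ->
    e a b -> b.2 = x ** ev r g -> (g.1 < 3)%N ->
  forall p, size p = k -> nbwalk a b p ->
  exists g', [/\ (g'.1 < 3)%N, test (last b p).1 g'
               & (last b p).2 = x ** ev r g'].
Proof.
elim: k a b g => [|k IH] a b g; first by move=> /= ? ? ? ? [|//] _ _; exists g.
move=> /(@all_label (fun l => if label_step a.1 b.1 l then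
           forall_walk k b.1 l (eisK_mul g (volt b.1 l)) test else true)) h.
move=> ab bg g3 [|c p] //= [sp] /and3P[bc ac bp].
apply: (IH b c (eisK_mul g (volt b.1 c.1))) => //; last exact: eisK_mul_lt3; last first.
  by rewrite -(nbr_lab r_root bc) /= (evM r_root) ?volt_lt3 // bg (kmulA r_root).
by have := h c.1; rewrite label_stepP // ac.
Qed.

Lemma exists_walkP k (a b : NV n) x g test : exists_walk k a.1 b.1 g test ->
    e a b -> b.2 = x ** ev r g ->
  exists p, [/\ size p = k, nbwalk a b p & exists2 g', test (last b p).1 g'
               & (last b p).2 = x ** ev r g'].
Proof.
elim: k a b g => [|k IH] a b g.
  by move=> /= h ab bg; exists [::]; split=> //; exists g.
case/(@hasP _ (fun l => if label_step a.1 b.1 l then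
        exists_walk k b.1 l (eisK_mul g (volt b.1 l)) test else false)) => l.
move=> + + ab bg; rewrite mem_iota => l6; case: ifP => // abl h.
pose c := nbr r b (Ordinal l6).
have bc : e b c by rewrite (ncg_nbr r_root); case/andP: abl.
have ac : a != c by rewrite -(label_stepP ab bc).
have [|p [sp bp lp]] := IH b c _ h bc.
  by rewrite /= (evM r_root) ?volt_lt3 // bg (kmulA r_root).
by exists (c :: p); rewrite /= sp bc ac.
Qed.

Definition vturn (a b c d : NV n) : bool := turn a.1 b.1 c.1 d.1.

Definition arc3 (a b c d : NV n) : bool :=
  [&& e a b, e b c, e c d, a != c & b != d].

Lemma on_12cycleP a b c d f : arc3 a b c d -> arc3 b c d f ->
  on_12cycle a b c d f <-> vturn a b c d = vturn b c d f.
Proof.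
move=> /and5P[ab bc cd ac bd] /and5P[_ _ df _ cf].
have := turn_changes_openT a.1 b.1 c.1 d.1 f.1; rewrite /turn_changes_open.
case: ifP => [/negP[]|_].
  by rewrite !label_stepP // (ncg_side r_root ab) addbN addbb ac bd.
rewrite -[turn a.1 _ _ _]/(vturn a b c d) -[turn b.1 _ _ _]/(vturn b c d f).
set g := volt4 _ _ _ _ _.
have g3 : (g.1 < 3)%N by exact: eisK_mul_lt3.
have fg : f.2 = a.2 ** ev r g.
  rewrite /g /volt4 !(evM r_root) ?volt_lt3 // !(kmulA r_root).
  have lab v w : e v w -> v.2 ** V v.1 w.1 = w.2.
    by move=> vw; rewrite -[in RHS](nbr_lab r_root vw).
  by rewrite !lab.
case: ifP => [/eqP tt h|tt h]; split.
- by [].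
- move=> _; have [p [sp fp [g' /andP[/eqP la /eqP g1] lp]]] := exists_walkP h df fg.
  exists p; split=> //; rewrite g1 ev1 kmul1 in lp.
  by case: (last f p) la lp => [i y] /=; case: (a) => [i' y'] /= /val_inj-> ->.
- case=> p [sp fp lp].
  have [g' [g'3 t lg]] := forall_walkP h df fg g3 sp fp.
  rewrite lp eqxx in t lg; have /(visibly_nontrivialP g'3)/eqP[] := t.
  by apply: (@kmul_injr _ _ r_root a.2); rewrite kmul1.
- by move/eqP; rewrite tt.
Qed.

Lemma nbwalk_map (p : {perm NV n}) a b s : p \in GAut e ->
  nbwalk (p a) (p b) (map p s) = nbwalk a b s.
Proof.
move=> /GAutP hp; elim: s a b => [|c s IH] a b //=.
by rewrite IH hp (inj_eq perm_inj).
Qed.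

Lemma on_12cycle_aut (p : {perm NV n}) a b c d f : p \in GAut e ->
  on_12cycle a b c d f -> on_12cycle (p a) (p b) (p c) (p d) (p f).
Proof.
move=> hp [s [ss ws ls]]; exists (map p s).
by rewrite size_map (nbwalk_map _ _ _ hp) last_map ls.
Qed.

Lemma arc3_aut (p : {perm NV n}) a b c d : p \in GAut e ->
  arc3 (p a) (p b) (p c) (p d) = arc3 a b c d.
Proof. by move/GAutP=> hp; rewrite /arc3 !hp !(inj_eq perm_inj). Qed.

Definition turn_shift (p : {perm NV n}) a b c d : bool :=
  vturn (p a) (p b) (p c) (p d) (+) vturn a b c d.

(** Automorphisms preserve lying on a 12-cycle, hence by [on_12cycleP] the equality of consecutive
    turns: both turns change or neither does. *)
Lemma turn_shift_next (p : {perm NV n}) a b c d f : p \in GAut e ->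
  arc3 a b c d -> arc3 b c d f -> turn_shift p a b c d = turn_shift p b c d f.
Proof.
move=> hp h h'.
have q : on_12cycle a b c d f <-> on_12cycle (p a) (p b) (p c) (p d) (p f).
  split; first exact: on_12cycle_aut.
  have hv : p^-1%g \in GAut e by rewrite groupV.
  by move/(on_12cycle_aut hv); rewrite !permK.
have [q1 q2] := q; move: q1 q2; rewrite /turn_shift => q1 q2.
have [A1 A2] := on_12cycleP h h'.
have [B1 B2] : on_12cycle (p a) (p b) (p c) (p d) (p f) <->
    vturn (p a) (p b) (p c) (p d) = vturn (p b) (p c) (p d) (p f).
  by apply: on_12cycleP; rewrite arc3_aut.
move: (fun x => B1 (q1 (A2 x))) (fun x => A1 (q2 (B2 x))).
do 4![case: (vturn _ _ _ _) => //=]; intuition.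
Qed.
End TwelveCycles.

Definition label_arc3 i j k l :=
  [&& side i (+) side j, label_step i j k & label_step j k l].

Lemma turn_rev_label (i j k l : 'I_6) : label_arc3 i j k l ->
  turn l k j i = ~~ turn i j k l.
Proof.
have : all (fun i => all (fun j => all (fun k => all (fun l =>
  label_arc3 i j k l ==> (turn l k j i == ~~ turn i j k l))
  (iota 0 6)) (iota 0 6)) (iota 0 6)) (iota 0 6) by vm_compute.
move/all_label/(_ i)/all_label/(_ j)/all_label/(_ k)/all_label/(_ l)/implyP.
by move=> h /h/eqP.
Qed.

(** The two continuations of a 2-arc have opposite turns, so a first 2-arc and a sequence of turns
    determine a walk. *)
Lemma turn_inj_label (i j k l m : 'I_6) :
  label_arc3 i j k l -> label_arc3 i j k m -> turn i j k l = turn i j k m -> l = m.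
Proof.
have : all (fun i => all (fun j => all (fun k => all (fun l => all (fun m =>
  [&& label_arc3 i j k l, label_arc3 i j k m & turn i j k l == turn i j k m]
   ==> (l == m))
  (iota 0 6)) (iota 0 6)) (iota 0 6)) (iota 0 6)) (iota 0 6) by vm_compute.
move/all_label/(_ i)/all_label/(_ j)/all_label/(_ k)/all_label/(_ l)/all_label/(_ m).
by move=> /implyP h il im lm; apply/val_inj/eqP/h; rewrite il im lm eqxx.
Qed.

Lemma label_step_ex (i j : 'I_6) : exists l : 'I_6, label_step i j l.
Proof.
have : all (fun i => all (fun j => has (label_step i j) (iota 0 6))
  (iota 0 6)) (iota 0 6) by vm_compute.
move/all_label/(_ i)/all_label/(_ j)/hasP => [l]; rewrite mem_iota => l6 h.
by exists (Ordinal l6).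
Qed.

(** * Propagation of turns, and rigidity of turn-preserving automorphisms *)

Section Rigidity.
Variables (n : nat) (r : 'Z_n).
Hypotheses (n7 : (7 <= n)%N) (r_root : r ^+ 2 + r + 1 = 0).
Local Notation e := (ncg r).
Local Notation arc3 := (arc3 r).
Implicit Types (p q : {perm NV n}) (a b c d f v w : NV n).

Lemma arc3_label a b c d : arc3 a b c d -> label_arc3 a.1 b.1 c.1 d.1.
Proof.
case/and5P=> ab bc cd ac bd.
rewrite /label_arc3 (label_stepP r_root ab bc) (label_stepP r_root bc cd) ac bd.
by rewrite (ncg_side r_root ab) addbN addbb.
Qed.

Lemma arc3_rev a b c d : arc3 a b c d -> arc3 d c b a.
Proof.
case/and5P=> ab bc cd ac bd.
by rewrite /arc3 ncg_sym cd ncg_sym bc ncg_sym ab eq_sym bd eq_sym ac.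
Qed.

Lemma vturn_rev a b c d : arc3 a b c d -> vturn d c b a = ~~ vturn a b c d.
Proof. by move/arc3_label/turn_rev_label. Qed.

Lemma vturn_inj a b c d d' : arc3 a b c d -> arc3 a b c d' ->
  vturn a b c d = vturn a b c d' -> d = d'.
Proof.
move=> h h' /(turn_inj_label (arc3_label h) (arc3_label h')) dd'.
by case/and5P: h h' => _ _ cd _ _ /and5P[_ _ cd' _ _]; apply: ncg_inj cd cd' dd'.
Qed.

Lemma arc_extend a b : e a b -> exists2 c, e b c & a != c.
Proof.
move=> ab; have [l abl] := label_step_ex a.1 b.1.
have bl : e b (nbr r b l) by rewrite (ncg_nbr r_root); case/andP: abl.
by exists (nbr r b l) => //; rewrite -(label_stepP r_root ab bl).
Qed.

Lemma arc_extend_back b c : e b c -> exists2 a, e a b & a != c.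
Proof.
rewrite ncg_sym => /arc_extend[a ba ca]; exists a; first by rewrite ncg_sym.
by rewrite eq_sym.
Qed.

Lemma has_nbr v : exists w, e v w.
Proof.
have [l vl] := label_step_ex v.1 v.1.
by exists (nbr r v l); rewrite (ncg_nbr r_root); case/andP: vl.
Qed.

Lemma ncg_ind (P : NV n -> Prop) v : P v -> (forall w w', P w -> e w w' -> P w') ->
  forall w, P w.
Proof.
move=> Pv step w; have /connectP[s] := ncg_connected r_root v w.
elim: s v Pv => [|x s IH] v Pv /=; first by move=> _ ->.
by case/andP=> vx; apply: IH; apply: step Pv vx.
Qed.

Lemma turn_shift_rev p a b c d : p \in GAut e -> arc3 a b c d ->
  turn_shift p d c b a = turn_shift p a b c d.
Proof.
move=> hp h; have hp' : arc3 (p a) (p b) (p c) (p d) by rewrite arc3_aut.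
by rewrite /turn_shift (vturn_rev h) (vturn_rev hp'); do 2 case: (vturn _ _ _ _).
Qed.

(** 3-arcs with a common successor or predecessor have equal shifts. Extending forward to [f] frees
    [a]; extending back to [z] frees [d]. *)
Lemma turn_shift_ends p a a' b c d d' : p \in GAut e ->
  arc3 a b c d -> arc3 a' b c d' -> turn_shift p a b c d = turn_shift p a' b c d'.
Proof.
move=> hp /and5P[ab bc cd ac bd] /and5P[ab' _ cd' ac' bd'].
have [f df cf] := arc_extend cd; have [z za zb] := arc_extend_back ab'.
have h1 : arc3 b c d f by rewrite /arc3 bc cd df bd cf.
have h2 : arc3 z a' b c by rewrite /arc3 za ab' bc zb ac'.
have a1 : arc3 a b c d by rewrite /arc3 ab bc cd ac bd.
have a2 : arc3 a' b c d by rewrite /arc3 ab' bc cd ac' bd.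
have a3 : arc3 a' b c d' by rewrite /arc3 ab' bc cd' ac' bd'.
rewrite (turn_shift_next n7 r_root hp a1 h1) -(turn_shift_next n7 r_root hp a2 h1).
by rewrite -(turn_shift_next n7 r_root hp h2 a2) (turn_shift_next n7 r_root hp h2 a3).
Qed.

(** When [b] and [b'] differ, (a, b, c, b') is followed by (b, c, b', a'), the reverse of (a', b',
    c, b), and reversal leaves the shift unchanged. *)
Lemma turn_shift_third p a b a' b' c d d' : p \in GAut e ->
  arc3 a b c d -> arc3 a' b' c d' -> turn_shift p a b c d = turn_shift p a' b' c d'.
Proof.
move=> hp h h'; have [bb'|bb'] := eqVneq b b'.
  by move: h'; rewrite -bb'; apply: turn_shift_ends.
case/and5P: (h) (h') => ab bc cd ac bd /and5P[ab' bc' cd' ac' bd'].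
have a1 : arc3 a b c b' by rewrite /arc3 ab bc ncg_sym bc' ac bb'.
have a2 : arc3 a' b' c b by rewrite /arc3 ab' bc' ncg_sym bc ac' eq_sym bb'.
rewrite (turn_shift_ends hp h a1) (turn_shift_next n7 r_root hp a1 (arc3_rev a2)).
by rewrite turn_shift_rev // (turn_shift_ends hp a2 h').
Qed.

(** The third vertex is moved along an edge from [w] to [w'] by the consecutive 3-arcs (a1, b1, w,
    w') and (b1, w, w', f); connectedness does the rest. *)
Lemma turn_shift_const p a b c d a' b' c' d' : p \in GAut e ->
  arc3 a b c d -> arc3 a' b' c' d' -> turn_shift p a b c d = turn_shift p a' b' c' d'.
Proof.
move=> hp h; move: c' a' b' d'.
apply: (ncg_ind (v := c)) => [a' b' d'|w w' IH ww' a' b' d' h']; first exact: turn_shift_third.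
have [b1 bw bw'] := arc_extend_back ww'; have [a1 ab aw] := arc_extend_back bw.
have [f wf w'f] := arc_extend ww'.
have h1 : arc3 a1 b1 w w' by rewrite /arc3 ab bw ww' aw bw'.
have h2 : arc3 b1 w w' f by rewrite /arc3 bw ww' wf bw' w'f.
rewrite (IH _ _ _ h1) (turn_shift_next n7 r_root hp h1 h2).
exact: turn_shift_third h2 h'.
Qed.

Definition turn_preserving p := forall a b c d, arc3 a b c d -> ~~ turn_shift p a b c d.
Definition turn_reversing p := forall a b c d, arc3 a b c d -> turn_shift p a b c d.

Lemma turn_dichotomy p : p \in GAut e -> turn_preserving p \/ turn_reversing p.
Proof.
move=> hp; pose a : NV n := (inord 0, kone n).
have [b ab] := has_nbr a; have [c bc ac] := arc_extend ab.
have [d cd bd] := arc_extend bc.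
have h : arc3 a b c d by rewrite /arc3 ab bc cd ac bd.
case s: (turn_shift p a b c d); [right|left] => a' b' c' d' h'.
  by rewrite -(turn_shift_const hp h h').
by rewrite -(turn_shift_const hp h h') s.
Qed.

Lemma turn_preserving_fix2arc p a b c d : p \in GAut e -> turn_preserving p ->
  arc3 a b c d -> p a = a -> p b = b -> p c = c -> p d = d.
Proof.
move=> hp tp h pa pb pc; have := tp _ _ _ _ h; rewrite /turn_shift.
have := arc3_aut a b c d hp; rewrite pa pb pc h => h'.
by rewrite addbC negb_add => /eqP/(vturn_inj h h').
Qed.

Lemma turn_preserving_id p a b c : p \in GAut e -> turn_preserving p ->
  two_arc e a b c -> p a = a -> p b = b -> p c = c -> p = 1%g.
Proof.
move=> hp tp /and3P[ab bc ac] pa pb pc.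
(* Neighbours are included so that the induction step has a fixed 2-arc (b1, w, w') to continue
   from. *)
pose fixes v := p v = v /\ (forall w, e v w -> p w = w).
have fixed u v w : e u v -> e v w -> u != w -> p u = u -> p v = v -> p w = w ->
    fixes w.
  move=> uv vw uw pu pv pw; split=> // d wd; have [<- //|vd] := eqVneq v d.
  by apply: (turn_preserving_fix2arc (a := u) (b := v) (c := w)) => //;
     rewrite /arc3 uv vw wd uw vd.
apply/permP=> v; rewrite perm1; suff [] : fixes v by [].
apply: (ncg_ind (v := c)) v; first exact: fixed ab bc ac pa pb pc.
move=> w w' [pw fw] ww'; have [b1 bw bw'] := arc_extend_back ww'.
by apply: (fixed b1 w w') => //; [apply: fw; rewrite ncg_sym|apply: fw].
Qed.

Lemma turn_shiftM p q a b c d :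
  turn_shift (p * q)%g a b c d
  = turn_shift q (p a) (p b) (p c) (p d) (+) turn_shift p a b c d.
Proof. by rewrite /turn_shift !permM addbA addbK. Qed.

Lemma turn_preservingM p q : p \in GAut e ->
  turn_preserving p -> turn_preserving q -> turn_preserving (p * q)%g.
Proof.
move=> hp tp tq a b c d h; rewrite turn_shiftM (negbTE (tp _ _ _ _ h)) addbF.
by apply: tq; rewrite arc3_aut.
Qed.

Lemma turn_reversing_conj p q : p \in GAut e -> q \in GAut e ->
  turn_reversing p -> turn_preserving q -> turn_preserving (p^-1 * q * p)%g.
Proof.
move=> hp hq rp tq a b c d h; have hV : p^-1%g \in GAut e by rewrite groupV.
have h1 : arc3 (p^-1%g a) (p^-1%g b) (p^-1%g c) (p^-1%g d) by rewrite arc3_aut.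
rewrite turn_shiftM rp; last by rewrite arc3_aut ?groupM.
rewrite turn_shiftM (negbTE (tq _ _ _ _ h1)) addFb.
have := turn_shiftM p^-1%g p a b c d; rewrite mulVg rp //.
by rewrite {1}/turn_shift !perm1 addbb => <-.
Qed.

(* An edge-flipping involution p sends the 3-arc (a, x, y, p a) to its reverse,
   which has the opposite turn. *)
Lemma turn_preserving_no_flip p x y : p \in GAut e -> turn_preserving p ->
  e x y -> p x = y -> p y = x -> (p * p)%g <> 1%g.
Proof.
move=> hp tp xy px py pp; have [a ax ay] := arc_extend_back xy.
have ppa : p (p a) = a by rewrite -permM pp perm1.
have xpa : x != p a by rewrite -[X in X != _]py (inj_eq perm_inj) eq_sym.
have h : arc3 a x y (p a).
  rewrite /arc3 ax xy ay xpa !andbT.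
  by rewrite -px; move/GAutP: hp => ->; rewrite ncg_sym.
have := tp _ _ _ _ h; rewrite /turn_shift px py ppa vturn_rev //.
by case: (vturn _ _ _ _).
Qed.
End Rigidity.

(** * Lifting automorphisms of K_{3,3} *)

Definition eis3 := (eis * eis * eis)%type.

Definition eis_wsum (e : nat) : eis :=
  match e with 0%N => (0, 0) | 1%N => (1, 0) | _ => (1, 1) end.

(* The endomorphism of K sending h to h w and a, b, c to the vectors x, y, z;
   since (h w)^e = h^e (1 + r + ... + r^(e-1)) w, it acts on h^e v as below. *)
Definition eisK_end (w x y z : eis3) (g : eisK) : eisK :=
  let: (w1, w2, w3) := w in let: (x1, x2, x3) := x in
  let: (y1, y2, y3) := y in let: (z1, z2, z3) := z in
  let: (e, (v1, v2, v3)) := g in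
  let q := eis_wsum e in
  let comb u x y z := eis_add (eis_add (eis_mul q u) (eis_mul v1 x))
                              (eis_add (eis_mul v2 y) (eis_mul v3 z)) in
  (e, (comb w1 x1 y1 z1, comb w2 x2 y2 z2, comb w3 x3 y3 z3)).

(** Encodes the map taking (i, g) to ([ld_lab] i, alpha(g) [ld_sh] i), with alpha the endomorphism
    [ld_end] given by the four vectors. Shifts past the end of [ld_shift] are trivial. *)
Record lift_data := LiftData {
  ld_label : seq nat;
  ld_h : eis3; ld_a : eis3; ld_b : eis3; ld_c : eis3;
  ld_shift : seq eisK }.

Definition ld_lab d i := nth 0%N (ld_label d) i.
Definition ld_sh d i := nth eisK1 (ld_shift d) i.
Definition ld_end d := eisK_end (ld_h d) (ld_a d) (ld_b d) (ld_c d).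

(** The equation on darts says that this map sends neighbours to neighbours; the last clause says
    that it preserves turns. *)
Definition lift_ok (d : lift_data) : bool :=
  [&& perm_eq (ld_label d) (iota 0 6),
   all (fun i => (ld_sh d i).1 < 3)%N (iota 0 6),
   all (fun i => all (fun j =>
     (side (ld_lab d i) (+) side (ld_lab d j) == side i (+) side j) &&
     (side i (+) side j ==>
      (eisK_mul (ld_sh d i) (volt (ld_lab d i) (ld_lab d j)) ==
       eisK_mul (ld_end d (volt i j)) (ld_sh d j)))) (iota 0 6)) (iota 0 6) &
   all (fun i => all (fun j => all (fun k => all (fun l =>
     label_arc3 i j k l ==>
     (turn (ld_lab d i) (ld_lab d j) (ld_lab d k) (ld_lab d l) == turn i j k l))
     (iota 0 6)) (iota 0 6)) (iota 0 6)) (iota 0 6)].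

(** This lift and the next two act on labels as (v w)(y z), as (v w)(x y) and by an exchange of the
    two sides. Their vectors and shifts are solutions of the dart equations. *)
Definition lift_yz : lift_data :=
  LiftData [:: 0; 2; 1; 3; 5; 4]%N
    ((0, 0), (0, 0), (1, 0)) ((0, 0), (1, 0), (-1, -1))
    ((1, 0), (0, 0), (-1, -1)) ((0, 0), (0, 0), (-1, 0)) [::].

Definition lift_xy : lift_data :=
  LiftData [:: 0; 2; 1; 4; 3; 5]%N
    ((0, -1), (0, 0), (0, 0)) ((-1, 0), (0, 0), (0, 0))
    ((0, 1), (0, 0), (1, 0)) ((0, 1), (1, 0), (0, 0))
    [:: eisK1; (1%N, ((0, -1), (0, 0), (0, 0))); (2%N, (eis0, eis0, eis0))].

Definition lift_swap : lift_data :=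
  LiftData [:: 5; 4; 3; 2; 0; 1]%N
    (eis0, eis0, eis0) ((0, -1), (0, 1), (0, 0))
    ((0, 0), (0, 0), (1, 1)) ((0, 0), (1, 0), (0, 0))
    [:: eisK1; eisK1; (1%N, ((0, 0), (1, 0), (0, 0))); eisK1; eisK1;
        (2%N, (eis0, eis0, eis0))].

Lemma lift_ok_gens : all lift_ok [:: lift_yz; lift_xy; lift_swap].
Proof. by vm_compute. Qed.

Definition lift_gen (m : nat) := nth lift_swap [:: lift_yz; lift_xy] m.

Lemma lift_gen_ok m : lift_ok (lift_gen m).
Proof.
have /and4P[h1 h2 h3 _] := lift_ok_gens.
by case: m => [|[|[|m]]].
Qed.

Fixpoint words (k : nat) : seq (seq nat) :=
  if k is k'.+1 then
    let ws := words k' in ws ++ flatten [seq [seq m :: w | w <- ws] | m <- iota 0 3]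
  else [:: [::]].

Definition word_lab (w : seq nat) (i : nat) := foldl (fun j m => ld_lab (lift_gen m) j) i w.

(** Words of length at most 5 in the three lifts already carry the labels 3, 0, 4 to all 36 label
    2-arcs. *)
Lemma word_lab_trans (i j k : 'I_6) : side i (+) side j -> label_step i j k ->
  exists w, [/\ word_lab w 3 = i, word_lab w 0 = j & word_lab w 4 = k].
Proof.
have : all (fun i => all (fun j => all (fun k =>
    (side i (+) side j) && label_step i j k ==>
    has (fun w => [&& word_lab w 3 == i, word_lab w 0 == j & word_lab w 4 == k]) (words 5))
    (iota 0 6)) (iota 0 6)) (iota 0 6) by vm_compute.
move/all_label/(_ i)/all_label/(_ j)/all_label/(_ k)/implyP => h ij ijk.
have := h; rewrite ij ijk => /(_ isT)/hasP[w _ /and3P[/eqP wi /eqP wj /eqP wk]].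
by exists w.
Qed.

Section Lifts.
Variables (n : nat) (r : 'Z_n).
Hypotheses (n7 : (7 <= n)%N) (r_root : r ^+ 2 + r + 1 = 0).
Local Notation "g ** k" := (kmul r g k) (at level 40, left associativity).
Local Notation V i j := (ev r (volt i j)).
Local Notation e := (ncg r).
Local Notation ev := (ev r).
Local Notation eev := (eis_ev r).

(** The image is closed under adjacency, hence everything by connectedness; a surjection of a finite
    set onto itself is injective. *)
Lemma covering_aut (phi : NV n -> NV n) (f : 'I_6 -> 'I_6) : injective f ->
    (forall i j : 'I_6, side (f i) (+) side (f j) = side i (+) side j) ->
    (forall v, (phi v).1 = f v.1) ->
    (forall (v : NV n) (j : 'I_6), side v.1 (+) side j ->
       phi (nbr r v j) = nbr r (phi v) (f j)) ->
  exists2 p, p \in GAut e & p =1 phi.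
Proof.
move=> f_inj f_side phi_lab phi_nbr.
have phi_surj w : exists v, phi v = w.
  apply: (ncg_ind r_root (P := fun w => exists v, phi v = w)
    (v := phi (inord 0, kone n))) w; first by exists (inord 0, kone n).
  move=> w w' [v vw] ww'; have [g gK fK] := injF_bij f_inj.
  exists (nbr r v (g w'.1)); rewrite phi_nbr ?fK; first by rewrite vw (nbr_lab r_root).
  by rewrite -f_side fK -phi_lab vw (ncg_side r_root ww') addbN addbb.
have phi_inj : injective phi.
  apply/injectiveP/card_uniqP; rewrite size_codom; apply: eq_card => w.
  by have [v <-] := phi_surj w; rewrite codom_f.
exists (perm phi_inj); last exact: permE.
apply/GAutP=> v w; rewrite !permE !(ncgP r_root) !phi_lab f_side.
by case vw: (_ (+) _) => //=; rewrite -phi_nbr // (inj_eq phi_inj).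
Qed.

(** The vertex modulo the normal subgroup generated by a, b, c. *)
Definition fine (v : NV n) := (v.1, v.2.1).
Definition fine_respecting (p : {perm NV n}) :=
  forall v w, fine v = fine w -> fine (p v) = fine (p w).

Definition lifted (p : {perm NV n}) :=
  [/\ p \in GAut e, turn_preserving r p & fine_respecting p].

Lemma liftedM p q : lifted p -> lifted q -> lifted (p * q)%g.
Proof.
move=> [p1 p2 p3] [q1 q2 q3]; split; first exact: groupM.
- exact: turn_preservingM.
- by move=> v w vw; rewrite !permM; apply/q3/p3.
Qed.

Lemma lifted_translation k : exists2 p, lifted p & p =1 ltr r k.
Proof.
have [p pG pE] : exists2 p : {perm NV n}, p \in GAut e & p =1 ltr r k.
  by apply: (@covering_aut _ id) => // v j _; rewrite (ltr_nbr r_root).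
exists p => //; split=> //.
- by move=> a b c d _; rewrite /turn_shift !pE addbb.
- move=> [i [f x]] [j [d y]] []; rewrite !pE /fine /ltr /= => -> ->.
  by case: k {pE} x y => [? [[? ?] ?]] [[? ?] ?] [[? ?] ?].
Qed.

Definition wsum (f : nat) : 'Z_n := eev (eis_wsum f).
(** The cocycle rule for 1 + r + ... + r^(f-1), where exponents may be read modulo 3 because 1 + r +
    r^2 = 0. It makes [kend] multiplicative. *)
Lemma wsumD (f h : 'Z_3) : wsum (f + h)%R = r ^+ h * wsum f + wsum h.
Proof.
rewrite /wsum -(eis_ev_wpow r_root (ltn_ord h)) -(eis_evM r_root) -eis_evD.
by case: f h => [[|[|[|//]]] ?] [[|[|[|//]]] ?].
Qed.

Definition ev3 (x : eis3) : 'Z_n * 'Z_n * 'Z_n := (eev x.1.1, eev x.1.2, eev x.2).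

Definition kend (w x y z : 'Z_n * 'Z_n * 'Z_n) (g : Kt n) : Kt n :=
  let: (w1, w2, w3) := w in let: (x1, x2, x3) := x in
  let: (y1, y2, y3) := y in let: (z1, z2, z3) := z in
  let: (e, (v1, v2, v3)) := g in
  let q := wsum e in
  let comb u x y z := q * u + v1 * x + (v2 * y + v3 * z) in
  (e, (comb w1 x1 y1 z1, comb w2 x2 y2 z2, comb w3 x3 y3 z3)).

Lemma kendM w x y z g h : kend w x y z (g ** h) = kend w x y z g ** kend w x y z h.
Proof.
move: w x y z => [[w1 w2] w3] [[x1 x2] x3] [[y1 y2] y3] [[z1 z2] z3].
case: g h => [f [[u1 u2] u3]] [h [[v1 v2] v3]]; rewrite /kend /kmul wsumD.
by congr (_, (_, _, _)); ring.
Qed.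

Lemma ev_end w x y z g : (g.1 < 3)%N ->
  ev (eisK_end w x y z g) = kend (ev3 w) (ev3 x) (ev3 y) (ev3 z) (ev g).
Proof.
move: w x y z => [[w1 w2] w3] [[x1 x2] x3] [[y1 y2] y3] [[z1 z2] z3].
case: g => [f [[u1 u2] u3]] f3; rewrite /ev /eisK_end /kend /ev3 /=.
by rewrite !(eis_evD, eis_evM r_root) /wsum (modn_small f3).
Qed.

Lemma lift_exists d : lift_ok d ->
  exists2 p, lifted p & forall v : NV n, nat_of_ord (p v).1 = ld_lab d v.1.
Proof.
case/and4P=> lab_perm sh_lt3 d_ok d_turn.
have lab6 (i : 'I_6) : (ld_lab d i < 6)%N.
  have := perm_mem lab_perm (ld_lab d i); rewrite mem_iota /= => <-.
  by rewrite mem_nth // (perm_size lab_perm) size_iota ltn_ord.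
pose f (i : 'I_6) := Ordinal (lab6 i).
have f_inj : injective f.
  move=> i j /(congr1 val) /= /eqP; rewrite /ld_lab nth_uniq.
  - by move/eqP/val_inj.
  - by rewrite (perm_size lab_perm) size_iota.
  - by rewrite (perm_size lab_perm) size_iota.
  - by rewrite (perm_uniq lab_perm) iota_uniq.
pose al := kend (ev3 (ld_h d)) (ev3 (ld_a d)) (ev3 (ld_b d)) (ev3 (ld_c d)).
pose phi (v : NV n) : NV n := (f v.1, al v.2 ** ev (ld_sh d v.1)).
have f_side (i j : 'I_6) : side (f i) (+) side (f j) = side i (+) side j.
  by have /all_label/(_ i)/all_label/(_ j)/andP[/eqP] := d_ok.
have [p pG pE] : exists2 p : {perm NV n}, p \in GAut e & p =1 phi.
  apply: (covering_aut f_inj f_side) => // v j vj.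
  (* Once the image of [v.2] under [al] is cancelled on the left, the dart equation of [lift_ok],
     evaluated at [r], remains. *)
  rewrite /phi /nbr /=; congr (_, _); rewrite /al kendM -!(kmulA r_root).
  congr (_ ** _); rewrite -ev_end ?volt_lt3 //.
  have /all_label/(_ j) sj := sh_lt3.
  rewrite -(evM r_root) // -(evM r_root) ?volt_lt3 //; congr ev.
  have /all_label/(_ v.1)/all_label/(_ j)/andP[_ /implyP/(_ vj)/eqP] := d_ok.
  by move=> ->.
exists p; last by move=> v; rewrite pE.
split=> //.
- move=> a b c g /(arc3_label r_root) abcg; rewrite /turn_shift !pE /vturn /=.
  have /all_label/(_ a.1)/all_label/(_ b.1)/all_label/(_ c.1)/all_label/(_ g.1) := d_turn.
  by rewrite abcg => /eqP->; rewrite addbb.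
(* [al] keeps the exponent of h, and the shift depends on the label only. *)
- move=> [i [h x]] [j [l y]] []; rewrite !pE /fine /phi /= => -> ->.
  congr (_, _); rewrite /al; case: (ev3 _) (ev3 _) (ev3 _) (ev3 _) (ev _) x y.
  move=> [? ?] ? [[? ?] ?] [[? ?] ?] [[? ?] ?] [? [[? ?] ?]] [[? ?] ?] [[? ?] ?].
  by [].
Qed.

Lemma lift_word w :
  exists2 p, lifted p & forall v : NV n, nat_of_ord (p v).1 = word_lab w v.1.
Proof.
rewrite /word_lab; elim/last_ind: w => [|w m [p pL pE]].
  have [p pL pE] := lifted_translation (kone n).
  by exists p => // v; rewrite pE.
have [q qL qE] := lift_exists (lift_gen_ok m).
exists (p * q)%g; first exact: liftedM.
by move=> v; rewrite permM qE pE foldl_rcons.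
Qed.

Definition base i : NV n := (inord i, kone n).

Lemma base_arcs : e (base 3) (base 0) /\ e (base 0) (base 4).
Proof.
have z0 : inZp 0 = 0 :> 'Z_3 by apply/val_inj.
by split; rewrite /base (ncgE r_root) !inordK //= k1mul ev1.
Qed.

(** A word gives the right labels, then a translation the right middle vertex; the two ends follow,
    being determined by their labels. *)
Lemma lifted_trans a b c : two_arc e a b c ->
  exists p, [/\ lifted p, p (base 3) = a, p (base 0) = b & p (base 4) = c].
Proof.
case/and3P=> ab bc ac.
have [w [wa wb wc]] : exists w, [/\ word_lab w 3 = a.1, word_lab w 0 = b.1
    & word_lab w 4 = c.1].
  apply: word_lab_trans; last by rewrite (label_stepP r_root).
  by rewrite (ncg_side r_root ab) addbN addbb.
have [p pL pE] := lift_word w.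
have [q qL qE] := lifted_translation (b.2 ** kinv r (p (base 0)).2).
have [pqG _ _] := liftedM pL qL; have [e1 e2] := base_arcs.
have pqb : (p * q)%g (base 0) = b.
  rewrite permM qE /ltr -(kmulA r_root) kVmul // kmul1.
  case: (b) wb => i g /= wb; congr (_, _); apply/val_inj.
  by rewrite /= pE -wb inordK.
have pqE v : nat_of_ord ((p * q)%g v).1 = word_lab w v.1 by rewrite permM qE pE.
exists (p * q)%g; split=> //; first exact: liftedM.
- apply: (ncg_inj r_root (v := b)); rewrite 1?ncg_sym //.
    by rewrite -pqb; move/GAutP: pqG => ->.
  by apply/val_inj; rewrite /= pqE -wa inordK.
- apply: (ncg_inj r_root (v := b)) => //.
    by rewrite -pqb; move/GAutP: pqG => ->.
  by apply/val_inj; rewrite /= pqE -wc inordK.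
Qed.
End Lifts.

(** * Walks coded by turns, and the exclusion of turn-reversing automorphisms *)

(* The 2-arc with labels i, j, k whose middle vertex is (j, g). *)
Definition arc_state := (nat * nat * nat * eisK)%type.

(** On label 2-arcs the list is nonempty by [lab_nextP], so the default 0 does not occur. *)
Definition lab_next (t : bool) (i j k : nat) : nat :=
  head 0%N [seq l <- iota 0 6 | label_step j k l && (turn i j k l == t)].

(** A turn advances the 2-arc by one edge, so a sequence of turns codes a walk; a turn-reversing
    automorphism maps it to the walk of the negated sequence. *)
Definition arc_step (s : arc_state) (t : bool) : arc_state :=
  let: (i, j, k, g) := s in (j, k, lab_next t i j k, eisK_mul g (volt j k)).

Definition arc_state_ok (s : arc_state) : bool :=
  let: (i, j, k, g) := s in
  [&& i < 6, j < 6, k < 6, side i (+) side j, label_step i j k & g.1 < 3]%N.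

Definition arc_base (g : eisK) : arc_state := (3, 0, 4, g)%N.

Lemma lab_nextP t (i j k : 'I_6) : side i (+) side j -> label_step i j k ->
  let l := lab_next t i j k in
  [/\ (l < 6)%N, label_step j k l & turn i j k l = t].
Proof.
have : all (fun i => all (fun j => all (fun k => all (fun t =>
    (side i (+) side j) && label_step i j k ==>
    has (fun l => label_step j k l && (turn i j k l == t)) (iota 0 6))
    [:: true; false])
    (iota 0 6)) (iota 0 6)) (iota 0 6) by vm_compute.
move/all_label/(_ i)/all_label/(_ j)/all_label/(_ k)/allP/(_ t) => h ij ijk.
have /h : t \in [:: true; false] by case: t {h}.
rewrite ij ijk has_filter /lab_next; set s := [seq _ <- _ | _] => s0.
have : head 0%N s \in s by case: s s0 => // x s _; rewrite inE eqxx.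
by rewrite {2}/s mem_filter mem_iota => /andP[/andP[? /eqP ?] ?].
Qed.

Section NoFlip.
Variables (n : nat) (r : 'Z_n).
Hypotheses (n7 : (7 <= n)%N) (r_root : r ^+ 2 + r + 1 = 0).
Local Notation "g ** k" := (kmul r g k) (at level 40, left associativity).
Local Notation e := (ncg r).
Local Notation arc3 := (arc3 r).

Definition arc_mid (s : arc_state) : NV n :=
  let: (i, j, k, g) := s in (inord j, ev r g).
Definition arc_tail (s : arc_state) : NV n :=
  let: (i, j, k, g) := s in nbr r (arc_mid s) (inord i).
Definition arc_head (s : arc_state) : NV n :=
  let: (i, j, k, g) := s in nbr r (arc_mid s) (inord k).

Lemma arc_step_ok s t : arc_state_ok s -> arc_state_ok (arc_step s t).
Proof.
case: s => [[[i j] k] g] /and3P[i6 j6 /and4P[k6 ij ijk g3]].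
have [l6 jkl _] := @lab_nextP t (Ordinal i6) (Ordinal j6) (Ordinal k6) ij ijk.
rewrite /arc_state_ok /arc_step j6 k6 l6 jkl eisK_mul_lt3 !andbT.
by case/andP: ijk.
Qed.

Lemma arc_step_mid s t : arc_state_ok s -> arc_mid (arc_step s t) = arc_head s.
Proof.
case: s => [[[i j] k] g] /and3P[i6 j6 /and4P[k6 ij ijk g3]] /=.
by rewrite (evM r_root) ?volt_lt3 // /nbr /= !inordK.
Qed.

Lemma arc_step_tail s t : arc_state_ok s -> arc_tail (arc_step s t) = arc_mid s.
Proof.
move=> ok; have := arc_step_mid t ok; case: s ok => [[[i j] k] g] ok /=.
move=> ->; apply: (nbr_lab r_root (w := (inord j, ev r g))); rewrite ncg_sym.
rewrite (ncg_nbr r_root) /=; case/and3P: ok => i6 j6 /and4P[k6 ij /andP[jk _] g3].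
by rewrite !inordK.
Qed.

Lemma arc_step_arc3 s t : arc_state_ok s ->
  let d := arc_head (arc_step s t) in
  arc3 (arc_tail s) (arc_mid s) (arc_head s) d /\
  vturn (arc_tail s) (arc_mid s) (arc_head s) d = t.
Proof.
move=> ok; have := arc_step_mid t ok; case: s ok => [[[i j] k] g] ok.
rewrite /arc_step; set l := lab_next t i j k.
rewrite /arc_head -/(arc_head (i, j, k, g)) => ->.
case/and3P: ok => i6 j6 /and4P[k6 ij ijk g3].
have [l6 jkl tl] := @lab_nextP t (Ordinal i6) (Ordinal j6) (Ordinal k6) ij ijk.
split; last by rewrite /vturn /= !inordK.
have e1 : e (arc_tail (i, j, k, g)) (arc_mid (i, j, k, g)).
  by rewrite ncg_sym (ncg_nbr r_root) /= !inordK // addbC.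
have e2 : e (arc_mid (i, j, k, g)) (arc_head (i, j, k, g)).
  by rewrite (ncg_nbr r_root) /= !inordK //; case/andP: ijk.
have e3 : e (arc_head (i, j, k, g)) (nbr r (arc_head (i, j, k, g)) (inord l)).
  by rewrite (ncg_nbr r_root) /= !inordK //; case/andP: jkl.
rewrite /arc3 e1 e2 e3 -(label_stepP r_root e1 e2) -(label_stepP r_root e2 e3) /=.
by rewrite !inordK // ijk jkl.
Qed.

Definition tracks (p : {perm NV n}) s s' :=
  [/\ p (arc_tail s) = arc_tail s', p (arc_mid s) = arc_mid s'
    & p (arc_head s) = arc_head s'].

Lemma tracks_step p s s' t : p \in GAut e -> turn_reversing r p ->
    arc_state_ok s -> arc_state_ok s' ->
  tracks p s s' -> tracks p (arc_step s t) (arc_step s' (~~ t)).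
Proof.
move=> pG rp ok ok' [pa pb pc]; split.
- by rewrite !arc_step_tail.
- by rewrite !arc_step_mid.
have [h tt] := arc_step_arc3 t ok; have [h' tt'] := arc_step_arc3 (~~ t) ok'.
apply: (vturn_inj r_root _ h'); first by rewrite -pa -pb -pc arc3_aut.
have := rp _ _ _ _ h; rewrite /turn_shift pa pb pc tt tt' addbC.
by move/addbP.
Qed.

Lemma tracks_walk p s s' ts : p \in GAut e -> turn_reversing r p ->
    arc_state_ok s -> arc_state_ok s' -> tracks p s s' ->
  tracks p (foldl arc_step s ts) (foldl arc_step s' (map negb ts)).
Proof.
move=> pG rp; elim: ts s s' => //= t ts IH s s' ok ok' pss'.
by apply: IH; rewrite ?arc_step_ok //; apply: tracks_step.
Qed.

Lemma arc_base_ltr g : [/\ arc_tail (arc_base g) = ltr r (ev r g) (base n 3),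
  arc_mid (arc_base g) = ltr r (ev r g) (base n 0) &
  arc_head (arc_base g) = ltr r (ev r g) (base n 4)].
Proof.
have [e1 e2] := base_arcs r_root; rewrite ncg_sym in e1.
have m : arc_mid (arc_base g) = ltr r (ev r g) (base n 0) by rewrite /ltr /= kmul1.
split=> //; rewrite /arc_base /arc_tail /arc_head -/(arc_base g) m -(ltr_nbr r_root).
- by congr (ltr _ _ _); apply: (nbr_lab r_root e1).
- by congr (ltr _ _ _); apply: (nbr_lab r_root e2).
Qed.

Lemma base_two_arc : two_arc e (base n 3) (base n 0) (base n 4).
Proof.
have [e1 e2] := base_arcs r_root.
by rewrite /two_arc e1 e2 -(label_stepP r_root e1 e2) /= !inordK.
Qed.

(** [p] sends the translate by [g] of the base 2-arc to its translate by [g']. Conjugating the first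
    translation by [p] and undoing the second thus fixes the base 2-arc; the result preserves turns,
    so it is the identity. *)
Lemma reversing_conj_translation p ts g g' : p \in GAut e -> turn_reversing r p ->
    tracks p (arc_base eisK1) (arc_base eisK1) ->
    foldl arc_step (arc_base eisK1) ts = arc_base g ->
    foldl arc_step (arc_base eisK1) (map negb ts) = arc_base g' ->
  forall v, p (ltr r (ev r g) v) = ltr r (ev r g') (p v).
Proof.
move=> pG rp p1 run run' v.
have ok : arc_state_ok (arc_base eisK1) by [].
have := tracks_walk ts pG rp ok ok p1; rewrite run run' /tracks.
have [-> -> ->] := arc_base_ltr g; have [-> -> ->] := arc_base_ltr g'.
move: p1; rewrite /tracks; have [-> -> ->] := arc_base_ltr eisK1.
rewrite ev1 !(ltr1 r) => -[pa pb pc] [ga gb gc].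
have [q [qG qt _] qE] := lifted_translation r_root (ev r g).
have [q' [q'G q't _] q'E] := lifted_translation r_root (kinv r (ev r g')).
have cG : (p^-1 * q * p)%g \in GAut e by rewrite !groupM ?groupV.
have fixed w : p w = w -> p (ltr r (ev r g) w) = ltr r (ev r g') w ->
    (p^-1 * q * p * q')%g w = w.
  move=> pw gw; rewrite !permM -{1}pw permK qE gw q'E -(ltrM r_root) kVmul //.
  by rewrite (ltr1 r).
have c1 : (p^-1 * q * p * q')%g = 1%g.
  have ct : turn_preserving r (p^-1 * q * p * q')%g.
    by apply: turn_preservingM => //; apply: turn_reversing_conj.
  have cG' : (p^-1 * q * p * q')%g \in GAut e by rewrite groupM.
  exact: (turn_preserving_id r_root cG' ct base_two_arc (fixed _ pa ga)
           (fixed _ pb gb) (fixed _ pc gc)).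
have := congr1 (fun c : {perm NV n} => c (p v)) c1.
rewrite !permM permK perm1 qE q'E => /(congr1 (ltr r (ev r g'))).
by rewrite -(ltrM r_root) kmulV (ltr1 r).
Qed.

Lemma no_reversing_fixing_base p : p \in GAut e -> turn_reversing r p ->
  ~ tracks p (arc_base eisK1) (arc_base eisK1).
Proof.
move=> pG rp p1.
(* In K these are a, b c^-1, h a c^-r and h^2 b: the translations reached by the two turn sequences
   below ([x] and [y]) and by their negations ([x'] and [y']). *)
pose x : eisK := (0%N, ((1, 0), (0, 0), (0, 0))).
pose x' : eisK := (0%N, ((0, 0), (1, 0), (-1, 0))).
pose y : eisK := (1%N, ((1, 0), (0, 0), (0, -1))).
pose y' : eisK := (2%N, ((0, 0), (1, 0), (0, 0))).
have px := @reversing_conj_translation p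
  [:: true; false; true; false; true; false] x x' pG rp p1 (erefl _) (erefl _).
have py := @reversing_conj_translation p
  [:: false; false; false; false] y y' pG rp p1 (erefl _) (erefl _).
pose xr m : Kt n := iter m (kmul r (ev r x)) (kone n).
pose xr' m : Kt n := iter m (kmul r (ev r x')) (kone n).
have pxr m v : p (ltr r (xr m) v) = ltr r (xr' m) (p v).
  elim: m v => [|m IH] v; first by rewrite !(ltr1 r).
  rewrite -[xr m.+1]/(ev r x ** xr m) -[xr' m.+1]/(ev r x' ** xr' m).
  by rewrite !(ltrM r_root) px IH.
have z0 : inZp 0 = 0 :> 'Z_3 by apply/val_inj.
have z1 : inZp 1 = 1 :> 'Z_3 by apply/val_inj.
have ev_int a : eis_ev r (a, 0) = a%:~R by rewrite /eis_ev /= mul0r addr0.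
have xrE m : xr m = (0, (m%:R, 0, 0)).
  elim: m => [|m IH] //; rewrite -[xr m.+1]/(ev r x ** xr m) IH /=.
  rewrite !ev_int z0 expr0 !mul1r !addr0.
  by rewrite -natr1 addrC.
have xrE' m : xr' m = (0, (0, m%:R, - m%:R)).
  elim: m => [|m IH]; first by rewrite oppr0.
  rewrite -[xr' m.+1]/(ev r x' ** xr' m) IH /= !ev_int z0 expr0 !mul1r !addr0 -natr1 opprD.
  by congr (_, (_, _, _)); ring.
(* Conjugation by an element of h Z_n^3 raises x to the power r, with [r] read as its natural
   representative. *)
have rel : ev r x ** ev r y = ev r y ** xr r.
  rewrite xrE natr_Zp /= !ev_int z0 z1 expr0 expr1 !mul1r !mulr0 !addr0 !add0r mulr1.
  by rewrite addrC.
have rel' : ev r x' ** ev r y' = ev r y' ** xr' r.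
  pose v := base n 0.
  have : p (ltr r (ev r x) (ltr r (ev r y) v)) = p (ltr r (ev r y) (ltr r (xr r) v)).
    by rewrite -!(ltrM r_root) rel.
  by rewrite px !py pxr -!(ltrM r_root) => /(ltr_injl r_root).
(* As y' has h-exponent 2, the last coordinates give r^2 = r. With r^2 = -r - 1 this makes -1 - 2w,
   of norm 3, evaluate to 0. *)
move: rel'; rewrite xrE' natr_Zp /= !ev_int => /(congr1 (fun k => k.2.2)) /=.
rewrite -[(2 %% _)%N]/2%N (r_sqr r_root) expr0 => rr.
have : eis_ev r (-1, -2) = 0.
  apply/eqP; rewrite -oppr_eq0 /eis_ev /= -(subrr (1 * 0%:~R - r)) -{1}rr.
  by apply/eqP; ring.
by apply/eqP/(eis_ev_neq0 r_root n7).
Qed.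
End NoFlip.

(** Parity: removing [x] and [f x], if distinct, leaves one point, which [f] must fix. *)
Lemma involution3_fixpoint (T : finType) (A : {set T}) (f : T -> T) :
    #|A| = 3%N -> (forall x, x \in A -> f x \in A) -> involutive f ->
  exists2 x, x \in A & f x = x.
Proof.
move=> A3 fA ff; have /card_gt0P[x xA] : (0 < #|A|)%N by rewrite A3.
have [fx|fx] := eqVneq (f x) x; first by exists x.
have /cards1P[y Ay] : #|A :\ x :\ f x| == 1%N.
  have := cardsD1 x A; rewrite A3 xA => /eqP; rewrite eqSS => /eqP Ax.
  have := cardsD1 (f x) (A :\ x); rewrite -Ax !inE fx fA // => /eqP.
  by rewrite eqSS eq_sym.
have : y \in A :\ x :\ f x by rewrite Ay set11.
rewrite !inE => /and3P[yfx yx yA]; exists y => //; apply/set1P; rewrite -Ay !inE.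
by rewrite fA // (can_eq ff) yx -[X in f y != X]ff (can_eq ff) yfx.
Qed.

(** * The full automorphism group *)

Section Main.
Variables (n : nat) (r : 'Z_n).
Hypotheses (n7 : (7 <= n)%N) (r_root : r ^+ 2 + r + 1 = 0).
Local Notation "g ** k" := (kmul r g k) (at level 40, left associativity).
Local Notation e := (ncg r).
Local Notation arc3 := (arc3 r).
Local Notation b0 := (base n 0).
Local Notation b3 := (base n 3).
Local Notation b4 := (base n 4).
Implicit Types (p q : {perm NV n}).

Lemma turn_preservingV p : p \in GAut e -> turn_preserving r p ->
  turn_preserving r p^-1%g.
Proof.
move=> pG tp a b c d h.
have h1 : arc3 (p^-1%g a) (p^-1%g b) (p^-1%g c) (p^-1%g d).
  by rewrite arc3_aut ?groupV.
have := turn_shiftM p^-1%g p a b c d; rewrite mulVg (negbTE (tp _ _ _ _ h1)) addFb.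
by move=> <-; rewrite /turn_shift !perm1 addbb.
Qed.

Lemma two_arc_aut p a b c : p \in GAut e ->
  two_arc e (p a) (p b) (p c) = two_arc e a b c.
Proof. by move/GAutP=> pG; rewrite /two_arc !pG (inj_eq perm_inj). Qed.

Lemma lifted_same_base p : p \in GAut e ->
  exists q, [/\ lifted r q, (p * q^-1)%g b3 = b3, (p * q^-1)%g b0 = b0
    & (p * q^-1)%g b4 = b4].
Proof.
move=> pG; have := two_arc_aut b3 b0 b4 pG; rewrite (base_two_arc r_root).
move=> /(lifted_trans r_root)[q [qL q3 q0 q4]].
by exists q; split=> //; rewrite permM -?q3 -?q0 -?q4 permK.
Qed.

(** Dividing a turn-reversing [p] by a lift would give one that fixes the base 2-arc, against
    [no_reversing_fixing_base]. *)
Lemma GAut_turn_preserving p : p \in GAut e -> turn_preserving r p.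
Proof.
move=> pG; have [//|rp] := turn_dichotomy n7 r_root pG.
have [q [[qG qt _] f3 f0 f4]] := lifted_same_base pG.
have pqG : (p * q^-1)%g \in GAut e by rewrite groupM ?groupV.
case: (no_reversing_fixing_base n7 r_root pqG).
  move=> a b c d h; rewrite turn_shiftM rp // addbT.
  by apply: turn_preservingV => //; rewrite arc3_aut.
rewrite /tracks; have [-> -> ->] := arc_base_ltr r_root eisK1.
by rewrite ev1 !(ltr1 r).
Qed.

Lemma GAut_id p a b c : p \in GAut e -> two_arc e a b c ->
  p a = a -> p b = b -> p c = c -> p = 1%g.
Proof. by move=> pG; apply: turn_preserving_id => //; apply: GAut_turn_preserving. Qed.

(** [p * q^-1] fixes a 2-arc, so it is trivial: every automorphism equals some lift [q]. *)
Lemma GAut_fine_respecting p : p \in GAut e -> fine_respecting p.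
Proof.
move=> pG; have [q [[qG _ qf] f3 f0 f4]] := lifted_same_base pG.
have pqG : (p * q^-1)%g \in GAut e by rewrite groupM ?groupV.
by have /mulg1_eq/invg_inj-> := GAut_id pqG (base_two_arc r_root) f3 f0 f4.
Qed.

Lemma GAut_two_arc_trans a b c a' b' c' : two_arc e a b c -> two_arc e a' b' c' ->
  exists2 p, p \in GAut e & [/\ p a = a', p b = b' & p c = c'].
Proof.
move=> /(lifted_trans r_root)[p [[pG _ _] <- <- <-]].
move=> /(lifted_trans r_root)[q [[qG _ _] <- <- <-]].
by exists (p^-1 * q)%g; [rewrite groupM ?groupV|rewrite !permM !permK].
Qed.

Lemma ncg_two_regular : two_regular e (GAut e).
Proof.
split=> [a b c a' b' c'|g a b c gG]; first exact: GAut_two_arc_trans.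
exact: GAut_id.
Qed.

Lemma ncg_arc_transitive : arc_transitive e.
Proof.
move=> x y x' y' xy xy'.
have [z yz xz] := arc_extend r_root xy; have [z' yz' xz'] := arc_extend r_root xy'.
have [||p pG [px py _]] := @GAut_two_arc_trans x y z x' y' z'.
- by rewrite /two_arc xy yz xz.
- by rewrite /two_arc xy' yz' xz'.
by exists p.
Qed.

Lemma no_involution_flip p x y : p \in GAut e -> e x y -> p x = y -> p y = x ->
  (p * p)%g <> 1%g.
Proof. by move=> pG; apply: turn_preserving_no_flip => //; apply: GAut_turn_preserving. Qed.

Lemma ncg_type22 : type22 e (GAut e).
Proof.
split; first exact: ncg_two_regular.
case=> p [x [y [pG p2 xy px py]]]; apply: (no_involution_flip pG xy px py).
by have := expg_order p; rewrite p2 expgS expg1.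
Qed.

(* A regular group of automorphisms would contain three elements moving a given
   vertex to a neighbour; inversion permutes them and hence fixes one. *)
Lemma ncg_not_cayley : ~ is_cayley e.
Proof.
case=> R [/subsetP RG [Rtrans Rfree]]; pose v := b0.
have Rinj p q : p \in R -> q \in R -> p v = q v -> p = q.
  move=> pR qR pq; have /Rfree : (p * q^-1)%g \in R by rewrite groupM ?groupV.
  by move=> /(_ v); rewrite permM pq permK => /(_ erefl)/mulg1_eq/invg_inj.
pose S := [set p in R | e v (p v)].
have S3 : #|S| = 3%N.
  apply: etrans (ncg_cubic r_root v).
  rewrite -(card_in_imset (f := fun p : {perm NV n} => p v) (D := S)); last first.
    by move=> p q; rewrite !inE => /andP[pR _] /andP[qR _]; apply: Rinj.
  apply/eq_card=> w; rewrite !inE; apply/imsetP/idP => [[p]|vw].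
    by rewrite inE => /andP[_ vp] ->.
  by have [p pR pw] := Rtrans v w; exists p; rewrite // inE pR pw.
have [p|p|p] := @involution3_fixpoint _ S (fun p => p^-1)%g S3.
- rewrite !inE groupV => /andP[pR vp]; rewrite pR /=.
  by move/GAutP: (RG _ pR) => <-; rewrite permKV ncg_sym.
- exact: invgK.
rewrite inE => /andP[pR vp] pV.
have pp : (p * p)%g = 1%g by rewrite -{1}pV mulVg.
apply: (no_involution_flip (RG _ pR) vp erefl _ pp).
by rewrite -permM pp perm1.
Qed.

Definition fine_kernel : {set {perm NV n}} :=
  [set p in GAut e | [forall v, fine (p v) == fine v]].

Lemma fine_kernelP p :
  reflect (p \in GAut e /\ forall v, fine (p v) = fine v) (p \in fine_kernel).
Proof.
rewrite [p \in _ in X in reflect _ X]inE; apply: (iffP andP) => -[pG h]; split=> //.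
  by move=> v; apply/eqP; move/forallP: h; apply.
by apply/forallP=> v; rewrite h.
Qed.

Lemma fine_kernel_group_set : group_set fine_kernel.
Proof.
apply/group_setP; split=> [|p q /fine_kernelP[pG pf] /fine_kernelP[qG qf]].
  by apply/fine_kernelP; split=> [|v]; rewrite ?group1 ?perm1.
by apply/fine_kernelP; split=> [|v]; rewrite ?groupM // permM qf pf.
Qed.
Canonical fine_kernel_group := Group fine_kernel_group_set.

(** The conjugate of [k] by [p] takes p u to p (k u); here k u and u agree modulo Z_n^3, and [p]
    respects this. *)
Lemma fine_kernel_normal : (fine_kernel <| GAut e)%g.
Proof.
apply/andP; split; first by apply/subsetP=> p /fine_kernelP[].
apply/subsetP=> p pG; rewrite inE; apply/subsetP=> q /imsetP[k /fine_kernelP[kG kf] ->].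
apply/fine_kernelP; split; first by rewrite groupJ.
move=> v; rewrite conjgE !permM -{2}[v](permKV p).
exact: (GAut_fine_respecting pG).
Qed.

(** Undoing the translation that matches [p] at [b0] leaves an automorphism that fixes [b0] and all
    labels, hence the neighbours of [b0], hence a 2-arc. *)
Lemma label_fixing_translation p : p \in GAut e -> (forall v, (p v).1 = v.1) ->
  p =1 ltr r (p b0).2.
Proof.
move=> pG pl; set k := (p b0).2.
have [q [qG _ _] qE] := lifted_translation r_root (kinv r k).
have pqG : (p * q)%g \in GAut e by rewrite groupM.
have pq0 : (p * q)%g b0 = b0.
  by rewrite permM qE /ltr; congr (_, _); [apply: pl|apply: kVmul].
have pql v : ((p * q)%g v).1 = v.1 by rewrite permM qE; apply: pl.
have pqn v : e b0 v -> (p * q)%g v = v.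
  move=> bv; apply: (ncg_inj r_root (v := b0)) => //.
  by rewrite -{1}pq0; move/GAutP: pqG => ->.
have pq1 : (p * q)%g = 1%g.
  have [e1 e2] := base_arcs r_root; apply: (GAut_id pqG (base_two_arc r_root)) => //.
    by apply: pqn; rewrite ncg_sym.
  exact: pqn.
move=> v; have := congr1 (fun c : {perm NV n} => ltr r k (c v)) pq1.
by rewrite permM qE perm1 -(ltrM r_root) kmulV (ltr1 r).
Qed.

Lemma fine_kernel_translation p : p \in fine_kernel ->
  p =1 ltr r (0, (p b0).2.2).
Proof.
move=> /fine_kernelP[pG pf] v.
have pl w : (p w).1 = w.1 by have := congr1 fst (pf w).
rewrite (label_fixing_translation pG pl) /ltr; congr (_, _ ** _).
by have := congr1 snd (pf b0); rewrite /fine /=; case: (p b0) => i [f x] /= ->.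
Qed.

Lemma fine_kernel_abelian : abelian fine_kernel.
Proof.
apply/centsP=> p /fine_kernel_translation + q /fine_kernel_translation.
move: (p b0).2.2 (q b0).2.2 => x y pE qE; apply/permP=> v.
rewrite !permM !pE !qE -!(ltrM r_root); congr (ltr _ _ _).
case: x {pE} y {qE} => [[x1 x2] x3] [[y1 y2] y3] /=.
by rewrite expr0 !mul1r !add0r; congr (_, (_, _, _)); rewrite addrC.
Qed.

Lemma card_fine_kernel : #|fine_kernel| = #|{: 'Z_n * 'Z_n * 'Z_n}|.
Proof.
have inj : {in fine_kernel &, injective (fun p => (p b0).2.2)}.
  move=> p q /fine_kernel_translation pE /fine_kernel_translation qE pq.
  by apply/permP=> v; rewrite pE qE pq.
rewrite -(card_in_imset inj); apply/eq_card=> x; rewrite inE.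
have [p [pG _ _] pE] := lifted_translation r_root (0, x).
apply/imsetP; exists p; last by rewrite pE /ltr kmul1.
apply/fine_kernelP; split=> // v; rewrite pE /fine /=.
by case: (x) v => [[? ?] ?] [i [f [[? ?] ?]]] /=; rewrite add0r.
Qed.

(** Regularity puts automorphisms in bijection with 2-arcs, recorded in [X] by the middle vertex and
    the labels of the ends; each vertex is the middle of six. *)
Lemma card_GAut : #|GAut e| = (#|{: NV n}| * 6)%N.
Proof.
pose X := [set x : NV n * ('I_6 * 'I_6) |
  (side x.1.1 (+) side x.2.1) && label_step x.2.1 x.1.1 x.2.2].
pose f p := (p b0, ((p b3).1, (p b4).1)).
have [e1 e2] := base_arcs r_root.
have f_inj : {in GAut e &, injective f}.
  move=> p q pG qG [pq0 pq3 pq4].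
  have pqG : (p * q^-1)%g \in GAut e by rewrite groupM ?groupV.
  suff /mulg1_eq/invg_inj : (p * q^-1)%g = 1%g by [].
  have pv v : e b0 v -> (p v).1 = (q v).1 -> p v = q v.
    move=> bv; apply: (ncg_inj r_root (v := p b0)); first by move/GAutP: pG => ->.
    by rewrite pq0; move/GAutP: qG => ->.
  apply: (GAut_id pqG (base_two_arc r_root)); rewrite permM.
  - by rewrite pv ?permK // ncg_sym.
  - by rewrite pq0 permK.
  - by rewrite pv ?permK.
have -> : #|GAut e| = #|X|.
  rewrite -(card_in_imset f_inj); apply/eq_card=> -[v [i k]]; rewrite inE /=.
  apply/imsetP/andP=> [[p pG [-> -> ->]]|[vi ivk]].
    have h3 : e (p b3) (p b0) by move/GAutP: pG => ->.
    have h4 : e (p b0) (p b4) by move/GAutP: pG => ->.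
    rewrite (label_stepP r_root h3 h4) (inj_eq perm_inj) (ncg_side r_root h3).
    by rewrite addNb addbb; split=> //; case/and3P: (base_two_arc r_root).
  have e3 : e (nbr r v i) v by rewrite ncg_sym (ncg_nbr r_root).
  have e4 : e v (nbr r v k) by rewrite (ncg_nbr r_root); case/andP: ivk.
  have : two_arc e (nbr r v i) v (nbr r v k).
    by rewrite /two_arc e3 e4 -(label_stepP r_root e3 e4).
  move/(lifted_trans r_root) => [p [[pG _ _] p3 p0 p4]].
  by exists p => //; rewrite /f p0 p3 p4.
have count (v : NV n) :
    (\sum_(y : 'I_6 * 'I_6 | (side v.1 (+) side y.1) && label_step y.1 v.1 y.2) 1)%N = 6%N.
  rewrite /label_step; move: (side v.1) => s; rewrite big_mkcond /=.
  rewrite -(pair_bigA _ (fun i k : 'I_6 =>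
     if (s (+) side i) && ((s (+) side k) && (k != i :> nat)) then 1%N else 0%N)) /=.
  by rewrite !big_ord_recl !big_ord0 /side /=; case: s.
rewrite -sum1_card (eq_bigl (fun x : NV n * ('I_6 * 'I_6) => true &&
  ((side x.1.1 (+) side x.2.1) && label_step x.2.1 x.1.1 x.2.2))); last first.
  by move=> x; rewrite inE.
rewrite -(pair_big_dep xpredT (fun (v : NV n) (y : 'I_6 * 'I_6) =>
  (side v.1 (+) side y.1) && label_step y.1 v.1 y.2) (fun _ _ => 1%N)) /=.
by rewrite (eq_bigr (fun=> 6%N)) // sum_nat_const.
Qed.

Lemma ncg_solvable : solvable (GAut e).
Proof.
rewrite (series_sol fine_kernel_normal) abelian_sol ?fine_kernel_abelian //=.
apply: Burnside_p_a_q_b.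
suff -> : #|(GAut e / fine_kernel)%g| = 108%N by [].
rewrite card_quotient ?normal_norm ?fine_kernel_normal //.
have := Lagrange (normal_sub fine_kernel_normal).
rewrite card_GAut card_fine_kernel /= !card_prod !card_ord => /eqP.
(* This is the order of ['Z_n]; the index is 18 m^3 times 6 divided by m^3, that is 108. *)
set m := (Zp_trunc n).+2.
have -> : (6 * (3 * (m * m * m)) * 6 = m * m * m * 108)%N by lia.
by rewrite eqn_pmul2l ?muln_gt0 // => /eqP.
Qed.
End Main.

Local Close Scope ring_scope.

Theorem theorem3p1 (n : nat) (r : 'Z_n) :
  7 <= n -> (r ^+ 2 + r + 1 = 0)%R ->
  [/\ connected_graph (ncg r), cubic (ncg r), arc_transitive (ncg r)
    & ~ is_cayley (ncg r)] /\
  (solvable (GAut (ncg r)) /\ type22 (ncg r) (GAut (ncg r))).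
Proof.
move=> n7 r_root; split; split.
- exact: ncg_connected.
- exact: ncg_cubic.
- exact: ncg_arc_transitive.
- exact: ncg_not_cayley.
- exact: ncg_solvable.
- exact: ncg_type22.
Qed.
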